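(* Let $\mathcal{G}$ be an ultragraph that satisfies Condition (RFUM2). Then the groupoids $G(X,\tilde\sigma)$ and $\Gamma(\mathsf{T},\sigma)$ are isomorphic as topological groupoids.
   Context: Ultragraph. An ultragraph is a quadruple $\mathcal{G}=(G^0,\mathcal{G}^1,r,s)$ with $G^0,\mathcal{G}^1$ countable sets, $s:\mathcal{G}^1\to G^0$, $r:\mathcal{G}^1\to P(G^0)\setminus\{\emptyset\}$ ($P$ = power set). $\mathcal{G}^0\subseteq P(G^0)$ is the smallest family containing $\emptyset$, all $\{v\}$ ($v\in G^0$), all $r(e)$ ($e\in\mathcal{G}^1$), and closed under finite unions and finite intersections (closure under relative complements is NOT required). $\mathcal{B}$ is the smallest family containing $\mathcal{G}^0$ and closed under relative complements, finite unions and finite intersections. Paths. $\mathcal{L}^*$ is the set consisting of the empty word $\omega$ ($|\omega|=0$) and all words $e_1\cdots e_n$ ($n\ge1$) of edges with $s(e_{i+1})\in r(e_i)$; $\mathfrak{p}^\infty$ is the set of infinite paths $e_1e_2\cdots$ with $s(e_{i+1})\in r(e_i)$. For $\alpha=e_1\cdots e_n$, $s(\alpha)=s(e_1)$, $r(\alpha)=r(e_n)$; $r(\omega)=G^0$. $\alpha_{1,n}$ is the beginning of $\alpha$ of length $n$. $\mathcal{B}_\alpha=\{A\in\mathcal{B}: A\subseteq r(\alpha)\}$. For $A\in\mathcal{B}$: $r(A,\omega)=A$; for $|\alpha|\ge1$, $r(A,\alpha)=r(\alpha)$ if $s(\alpha)\in A$ and $\emptyset$ otherwise. $\varepsilon(A)=\{e\in\mathcal{G}^1: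 s(e)\in A\}$; $G^0_s$ is the set of sinks (vertices $v$ with $s^{-1}(v)=\emptyset$). Tight spectrum. A filter in a poset with least element $0$ is a nonempty up-closed, down-directed subset not containing $0$; an ultrafilter is a maximal filter. $E(S)=\{(\alpha,A,\alpha):\alpha\in\mathcal{L}^*,\ \emptyset\ne A\in\mathcal{B}_\alpha\}\cup\{0\}$ is a meet semilattice with product $(\alpha,A,\alpha)(\beta,B,\beta)=(\beta,r(A,\gamma)\cap B,\beta)$ if $\beta=\alpha\gamma$ and $r(A,\gamma)\cap B\neq\emptyset$, symmetrically if $\alpha=\beta\gamma$, and $0$ otherwise; $p\le q$ iff $pq=p$. Filters in $E(S)$ carry the topology of pointwise convergence of their characteristic functions $E(S)\to\{0,1\}$; the set $\mathsf{T}$ of tight filters is the closure, in the space of all filters, of the set of ultrafilters in $E(S)$, with the subspace topology. Each filter $\xi$ in $E(S)$ has an associated word $\alpha\in\mathcal{L}^*\cup\mathfrak{p}^\infty$: the words occurring in nonzero elements of $\xi$ are exactly the finite beginnings of $\alpha$. For finite $n$, $0\le n\le|\alpha|$, $\xi_n=\{A\in\mathcal{B}:(\alpha_{1,n},A,\alpha_{1,n})\in\xi\}$. For each infinite path there is exactly one filter in $\mathsf{T}$ with it as associated word; a filter with finite associated word $\alpha$ is determined by the pair $(\alpha,\xi_{|\alpha|})$. Groupoid $\Gamma(\mathsf{T},\sigma)$. Let $\mathsf{T}^{(n)}$ be the set of $\xi\in\mathsf{T}$ whose associated word has length at least $n$. The map $\sigma:\mathsf{T}^{(1)}\to\mathsf{T}$: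 if $\xi$ has infinite word $\alpha_1\alpha_2\alpha_3\cdots$, $\sigma(\xi)$ is the tight filter with word $\alpha_2\alpha_3\cdots$; if $\xi$ has word $\alpha_1\cdots\alpha_n$, $n\ge2$, $\sigma(\xi)$ is given by the pair $(\alpha_2\cdots\alpha_n,\xi_n)$; if $\xi$ has word an edge $e$, $\sigma(\xi)$ is given by the pair $(\omega,\{A\in\mathcal{B}:A\supseteq C\text{ for some }C\in\xi_1\})$. Then $$\Gamma(\mathsf{T},\sigma)=\{(\xi,m-n,\eta): m,n\in\mathbb{N},\ \xi\in\mathsf{T}^{(m)},\ \eta\in\mathsf{T}^{(n)},\ \sigma^m(\xi)=\sigma^n(\eta)\}$$ with $(\xi,k,\eta)(\eta,l,\rho)=(\xi,k+l,\rho)$, $(\xi,k,\eta)^{-1}=(\eta,-k,\xi)$, and topology with basis the sets $\{(\xi,m-n,\eta):\xi\in U,\eta\in V,\sigma^m(\xi)=\sigma^n(\eta)\}$, $U\subseteq\mathsf{T}^{(m)}$, $V\subseteq\mathsf{T}^{(n)}$ open. Minimal sets. $A\in\mathcal{G}^0$ is a minimal infinite emitter if $|\varepsilon(A)|=\infty$ and $A$ has no proper subset in $\mathcal{G}^0$ that is an infinite emitter (i.e. $|\varepsilon(\cdot)|=\infty$) and no proper subset in $\mathcal{G}^0$ that is a finite emitter of infinite cardinality; $A_\infty$ is the set of these. $A\in\mathcal{G}^0$ is a minimal sink if $|A|=\infty$, $|\varepsilon(A)|<\infty$ and $A$ has no proper subset in $\mathcal{G}^0$ of infinite cardinality; $A_s$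 is the set of these. Condition (RFUM2): for each $e\in\mathcal{G}^1$, $r(e)$ is a finite union $\bigcup_{n=1}^kA_n$ where each $A_n$ is a minimal infinite emitter, or a minimal sink, or a singleton consisting of a sink or of a regular vertex (one with $0<|s^{-1}(v)|<\infty$). Boundary path space. $\mathfrak{p}$ is the set of pairs $(\alpha,A)$ with $\alpha$ a path of length $|\alpha|\ge1$, $A\in\mathcal{G}^0$, $A\subseteq r(\alpha)$, together with the pairs $(A,A)$, $A\in\mathcal{G}^0$ (length $0$). Let $\mathcal{G}^0_s=\{\{v\}:v\in G^0_s\}$. Put $X_{min}=\{(\alpha,A)\in\mathfrak{p}:|\alpha|\ge1,A\in A_\infty\}\cup\{(A,A):A\in A_\infty\}$, $X_{sin}=\{(\alpha,A)\in\mathfrak{p}:|\alpha|\ge1,A\in\mathcal{G}^0_s\cup A_s\}\cup\{(A,A):A\in\mathcal{G}^0_s\cup A_s\}$, $X_{fin}=X_{min}\sqcup X_{sin}$ and $X=\mathfrak{p}^\infty\sqcup X_{fin}$. Topology on $X$: for $(\beta,B)\in\mathfrak{p}$ with $|\beta|\ge1$, $D_{(\beta,B)}=\{y\in X:y=\beta\gamma,\ s(\gamma)\in B\}$, i.e. all infinite paths $\beta\gamma$ with $s(\gamma)\in B$, all $(\beta\gamma',C)\in X_{fin}$ with $|\gamma'|\ge1$, $s(\gamma')\in B$, and all $(\beta,C)\in X_{fin}$ with $C\subseteq B$. For $(\beta,B)\in X_{fin}$ and finite $F\subseteq\varepsilon(B)$, $S\subseteq B\cap G^0_s$, $$D_{(\beta,B),F,S}=\{(\beta,B)\}\cup\{y\in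 X:y=\beta\gamma',\ |\gamma'|\ge1,\ \gamma'_1\in\varepsilon(B)\setminus F\}\cup\{y\in X_{sin}:y=(\beta,\{v\}),\ v\in B\setminus S\},$$ where when $|\beta|=0$ (so $(\beta,B)=(B,B)$) $\beta\gamma'$ means $\gamma'$ and $(\beta,\{v\})$ means $(\{v\},\{v\})$; here $\gamma'$ is an infinite path or an ultrapath of length at least $1$. All these sets form a basis for the topology on $X$. Groupoid $G(X,\tilde\sigma)$. The shift $\tilde\sigma$ is the partially defined map on $X$, with domain the elements of length at least $1$: $\tilde\sigma(\gamma_1\gamma_2\gamma_3\cdots)=\gamma_2\gamma_3\cdots$ on infinite paths; $\tilde\sigma(\gamma_1\cdots\gamma_n,A)=(\gamma_2\cdots\gamma_n,A)$ if $n\ge2$; $\tilde\sigma(\gamma_1,A)=(A,A)$. Then $G(X,\tilde\sigma)=\{(x,m-n,y):x,y\in X,\ m,n\in\mathbb{N},\ \tilde\sigma^m(x)=\tilde\sigma^n(y)\}$ (with $x,y$ in the domains of $\tilde\sigma^m,\tilde\sigma^n$), multiplication $(x,k,y)(y,l,z)=(x,k+l,z)$, inverse $(x,k,y)^{-1}=(y,-k,x)$, and the Renault–Deaconu topology, with basis the sets $\{(x,m-n,y):x\in U,y\in W,\tilde\sigma^m(x)=\tilde\sigma^n(y)\}$, $U,W$ open in $X$ and contained in the domains of $\tilde\sigma^m,\tilde\sigma^n$ respectively. *)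

(* Defs.v *)
From HB Require Import structures.
From mathcomp Require Import all_boot all_order all_algebra.
From mathcomp Require Import all_classical topology.
Set Implicit Arguments.
Unset Strict Implicit.
Unset Printing Implicit Defensive.
Local Open Scope classical_set_scope.

Record ultragraph := Ultragraph {
  vertex : countType;
  edge : countType;
  src : edge -> vertex;
  rng : edge -> set vertex;
  rng_neq0 : forall e, rng e !=set0 }.

Section Ultragraph.
Variable G : ultragraph.
Local Notation V := (vertex G).
Local Notation E := (edge G).

Definition genvert : set (set V) :=
  smallest [set M : set (set V) | setU_closed M /\ setI_closed M]
    ([set set0] `|` range set1 `|` range (@rng G)).

Definition baseset : set (set V) :=
  smallest [set M : set (set V) |
      [/\ (forall A B, M A -> M B -> M (A `\` B)),
          setU_closed M & setI_closed M]]
    genvert.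

(* The empty word is [::]; it satisfies [is_path]. *)
Definition is_path (w : seq E) : bool := sorted (fun e f => src f \in rng e) w.

Definition is_inf_path (p : nat -> E) : Prop := forall i, rng (p i) (src (p i.+1)).

Definition range_of (w : seq E) : set V :=
  if w is e :: w' then rng (last e w') else setT.

Definition relrange (A : set V) (w : seq E) : set V :=
  if w is e :: w' then (if src e \in A then rng (last e w') else set0) else A.

Definition emits (A : set V) : set E := [set e | A (src e)].

Definition is_sink (v : V) : Prop := emits [set v] = set0.

Definition is_regular (v : V) : Prop :=
  emits [set v] !=set0 /\ finite_set (emits [set v]).

Lemma baseset_genvert (A : set V) : genvert A -> baseset A.
Proof. exact: sub_gen_smallest. Qed.

Lemma baseset0 : baseset set0.
Proof. by apply: baseset_genvert; apply: sub_gen_smallest; left; left. Qed.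

Lemma baseset_rng (e : E) : baseset (rng e).
Proof. by apply: baseset_genvert; apply: sub_gen_smallest; right; exists e. Qed.

Lemma basesetI : setI_closed baseset.
Proof.
move=> A B BA BB M /= [MC GM]; have [_ _ MI] := MC.
by apply: MI; [apply: BA|apply: BB].
Qed.

Lemma baseset_relrange (A : set V) (w : seq E) :
  baseset A -> baseset (relrange A w).
Proof.
case: w => [//|e w] _ /=; case: ifP => _; [exact: baseset_rng|exact: baseset0].
Qed.

(* [Idem w A _ _ _ _] is the nonzero idempotent (w, A, w). *)
Record idem := Idem {
  iword : seq E;
  iset : set V;
  iwordP : is_path iword;
  iset_neq0 : iset !=set0;
  iset_base : baseset iset;
  iset_sub : iset `<=` range_of iword }.

HB.instance Definition _ := gen_eqMixin idem.
HB.instance Definition _ := gen_choiceMixin idem.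

(* E(S), with [None] as its zero. *)
Definition ES := option idem.

(* (w, C `&` A, w) when p = (w, A, w), and 0 when C `&` A is empty. *)
Definition cut (C : set V) (hC : baseset C) (p : idem) : ES :=
  if pselect (C `&` iset p !=set0) is left h then
    Some (Idem (iwordP p) h (basesetI hC (iset_base p))
               (subset_trans (@subIsetr _ C (iset p)) (@iset_sub p)))
  else None.

Definition ESmul (x y : ES) : ES :=
  match x, y with
  | Some p, Some q =>
      if prefix (iword p) (iword q) then
        cut (baseset_relrange (drop (size (iword p)) (iword q)) (iset_base p)) q
      else if prefix (iword q) (iword p) then
        cut (baseset_relrange (drop (size (iword q)) (iword p)) (iset_base q)) p
      else None
  | _, _ => None
  end.

Definition ESle (x y : ES) : Prop := ESmul x y = x.

Definition is_filter (F : set ES) : Prop :=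
  [/\ F !=set0, ~ F None,
      (forall x y, F x -> ESle x y -> F y) &
      (forall x y, F x -> F y -> exists z, [/\ F z, ESle z x & ESle z y])].

Definition is_ultrafilter (F : set ES) : Prop :=
  is_filter F /\ forall F', is_filter F' -> F `<=` F' -> F' = F.

Definition charfun (F : [set F : set ES | is_filter F]) : {ptws ES -> bool} :=
  fun x => `[< set_val F x >].

Definition filters : topologicalType := initial_topology charfun.

Definition filter_set (F : filters) : set ES :=
  set_val (F : [set F : set ES | is_filter F]).

Definition tight : set filters :=
  closure [set F : filters | is_ultrafilter (filter_set F)].

Definition tight_spectrum : topologicalType := tight.

Definition elts (xi : tight_spectrum) : set ES := filter_set (set_val xi).

Inductive word := FinWord of seq E | InfWord of (nat -> E).

Definition is_word (a : word) : Prop :=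
  match a with FinWord w => is_path w | InfWord p => is_inf_path p end.

Definition beginnings (a : word) : set (seq E) :=
  match a with
  | FinWord w => [set u | prefix u w]
  | InfWord p => [set u | u = mkseq p (size u)]
  end.

Definition length_ge (n : nat) (a : word) : Prop :=
  if a is FinWord w then (n <= size w)%N else True.

Definition has_word (xi : tight_spectrum) (a : word) : Prop :=
  is_word a /\ [set u | exists2 p, elts xi (Some p) & iword p = u] = beginnings a.

(* xi_n, when [w] is the beginning of length n of the word of [xi] *)
Definition level (xi : tight_spectrum) (w : seq E) : set (set V) :=
  [set A | exists2 p, elts xi (Some p) & iword p = w /\ iset p = A].

Definition given_by (xi : tight_spectrum) (w : seq E) (F : set (set V)) : Prop :=
  has_word xi (FinWord w) /\ level xi w = F.

Definition tight_ge (n : nat) : set tight_spectrum :=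
  [set xi | exists2 a, has_word xi a & length_ge n a].

Definition is_shift (xi eta : tight_spectrum) : Prop :=
  [\/ exists2 p, has_word xi (InfWord p) &
        has_word eta (InfWord (fun i => p i.+1)),
      exists e f w, has_word xi (FinWord [:: e, f & w]) /\
        given_by eta (f :: w) (level xi [:: e, f & w])
    | exists2 e, has_word xi (FinWord [:: e]) &
        given_by eta [::]
          [set A | baseset A /\ exists2 C, level xi [:: e] C & C `<=` A]].

(* sigma, of domain [tight_ge 1]; there [xget] returns the only tight filter
   related to [xi] by [is_shift], and elsewhere the value is irrelevant. *)
Definition tight_shift (xi : tight_spectrum) : tight_spectrum :=
  xget xi (is_shift xi).

Definition min_inf_emitter (A : set V) : Prop :=
  [/\ genvert A, infinite_set (emits A) &
      forall C, genvert C -> C `<` A ->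
        ~ infinite_set (emits C) /\
        ~ (finite_set (emits C) /\ infinite_set C)].

Definition min_sink (A : set V) : Prop :=
  [/\ genvert A, infinite_set A, finite_set (emits A) &
      forall C, genvert C -> C `<` A -> ~ infinite_set C].

Definition RFUM2 : Prop :=
  forall e : E, exists (k : nat) (A : 'I_k -> set V),
    rng e = \bigcup_n A n /\
    forall n, [\/ min_inf_emitter (A n), min_sink (A n) |
      exists2 v, is_sink v \/ is_regular v & A n = [set v]].

(* The pair (A, A) of length 0 is encoded as ([::], A). *)
Definition ultrapath (x : seq E * set V) : Prop :=
  [/\ is_path x.1, genvert x.2 & x.2 `<=` range_of x.1].

Definition in_Xmin (x : seq E * set V) : Prop :=
  ultrapath x /\ min_inf_emitter x.2.

Definition in_Xsin (x : seq E * set V) : Prop :=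
  ultrapath x /\ ((exists2 v, is_sink v & x.2 = [set v]) \/ min_sink x.2).

Definition in_Xfin (x : seq E * set V) : Prop := in_Xmin x \/ in_Xsin x.

Inductive bpath :=
  | BInf (p : nat -> E) of is_inf_path p
  | BFin (x : seq E * set V) of in_Xfin x.

(* The y = w gamma with |gamma| >= 1 and first edge of gamma in [P]. *)
Definition extends (w : seq E) (P : set E) : set bpath :=
  [set y | match y with
    | BInf p _ => mkseq p (size w) = w /\ P (p (size w))
    | BFin x _ => exists e u, x.1 = w ++ e :: u /\ P e
    end].

Definition finpt (x : seq E * set V) : set bpath :=
  [set y | if y is BFin z _ then z = x else False].

Definition Dcyl (b : seq E) (B : set V) : set bpath :=
  extends b (emits B) `|` \bigcup_(C in [set C | C `<=` B]) finpt (b, C).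

Definition Dpt (b : seq E) (B : set V) (F : set E) (S : set V) : set bpath :=
  [set y | [\/ finpt (b, B) y, extends b (emits B `\` F) y |
    exists v, [/\ (B `\` S) v, in_Xsin (b, [set v]) & finpt (b, [set v]) y]]].

Definition bpath_basis : set (set bpath) :=
  [set D | (exists b B, [/\ ultrapath (b, B), (1 <= size b)%N & D = Dcyl b B])
    \/ exists b B F S, [/\ in_Xfin (b, B), finite_set F /\ F `<=` emits B,
         finite_set S /\ S `<=` B `&` is_sink & D = Dpt b B F S]].

(* [bpath_basis] is stable under intersection up to unions and covers [bpath],
   so it is a basis of the topology that it generates as a subbase. *)
HB.instance Definition _ := gen_eqMixin bpath.
HB.instance Definition _ := gen_choiceMixin bpath.
HB.instance Definition _ := isSubBaseTopological.Build bpath bpath_basis id.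

Definition bpath_ge (n : nat) : set bpath :=
  [set y | if y is BFin x _ then (n <= size x.1)%N else True].

Lemma ultrapath_behead w A : ultrapath (w, A) -> ultrapath (behead w, A).
Proof.
case: w => [//|e w] [/= pw gA sA]; split => //=.
  exact: path_sorted pw.
by case: w pw sA.
Qed.

Lemma in_Xfin_behead x : in_Xfin x -> in_Xfin (behead x.1, x.2).
Proof.
case: x => w A /=.
by case=> -[/ultrapath_behead ux h]; [left|right]; split.
Qed.

(* The shift, of domain [bpath_ge 1]; it fixes the elements of length 0. *)
Definition bpath_shift (y : bpath) : bpath :=
  match y with
  | BInf p hp => BInf (fun i => hp i.+1)
  | BFin x hx => BFin (in_Xfin_behead hx)
  end.

End Ultragraph.

(* [D n] is the domain of the n-th power of the partial map [f]. *)
Record rd_arrow (T : topologicalType) (D : nat -> set T) (f : T -> T) := RDArrow {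
  rd_left : T;
  rd_deg : int;
  rd_right : T;
  rd_arrowP : exists m n, [/\ D m rd_left, D n rd_right,
    rd_deg = (m%:Z - n%:Z)%R & iter m f rd_left = iter n f rd_right] }.

Section RenaultDeaconu.
Variables (T : topologicalType) (D : nat -> set T) (f : T -> T).
Local Notation arrow := (rd_arrow D f).

Definition rd_basic (U : set T) (m n : nat) (W : set T) : set arrow :=
  [set g | [/\ U (rd_left g), W (rd_right g), rd_deg g = (m%:Z - n%:Z)%R &
               iter m f (rd_left g) = iter n f (rd_right g)]].

Definition rd_basis : set (set arrow) :=
  [set Z | exists U m n W,
    [/\ open U /\ U `<=` D m, open W /\ W `<=` D n & Z = rd_basic U m n W]].

(* The intersection of two basic sets of degree m - n = m' - n', with m <= m',
   is [rd_basic (U `&` U') m n (W `&` W')]: they form a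
   basis of the topology that they generate as a subbase. *)
HB.instance Definition _ := gen_eqMixin arrow.
HB.instance Definition _ := gen_choiceMixin arrow.
HB.instance Definition _ := isSubBaseTopological.Build arrow rd_basis id.

(* The graph of the product: [g] and [h] are composable, with product [k]. *)
Definition rd_mul (g h k : arrow) : Prop :=
  [/\ rd_right g = rd_left h, rd_left k = rd_left g,
      rd_deg k = (rd_deg g + rd_deg h)%R & rd_right k = rd_right h].

Definition rd_inv (g : arrow) : arrow.
Proof.
apply: (@RDArrow T D f (rd_right g) (- rd_deg g)%R (rd_left g)).
abstract (by case: (rd_arrowP g) => m [n [Dm Dn dE fE]];
  exists n, m; split => //; rewrite dE GRing.opprB).
Defined.

End RenaultDeaconu.

(* The operations of a topological groupoid: the partial product, given by its
   graph, and the inversion.  The axioms are not bundled. *)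
Record groupoid_data := GroupoidData {
  arrows :> topologicalType;
  gmul : arrows -> arrows -> arrows -> Prop;
  ginv : arrows -> arrows }.

Definition rd_groupoid (T : topologicalType) (D : nat -> set T) (f : T -> T) :=
  GroupoidData (@rd_mul T D f) (@rd_inv T D f).

Definition topological_groupoid_iso (H K : groupoid_data) : Prop :=
  exists (phi : H -> K) (psi : K -> H),
    [/\ cancel phi psi /\ cancel psi phi,
        continuous phi /\ continuous psi,
        (forall g h k, gmul g h k <-> gmul (phi g) (phi h) (phi k)) &
        (forall g, phi (ginv g) = ginv (phi g))].

Definition boundary_groupoid (G : ultragraph) : groupoid_data :=
  rd_groupoid (@bpath_ge G) (@bpath_shift G).

Definition tight_groupoid (G : ultragraph) : groupoid_data :=
  rd_groupoid (@tight_ge G) (@tight_shift G).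

(* Main.v *)
Require Import Defs.
From mathcomp Require Import all_boot all_order all_algebra.
From mathcomp Require Import all_classical topology.
Set Implicit Arguments.
Unset Strict Implicit.
Unset Printing Implicit Defensive.
Local Open Scope classical_set_scope.

(** An element of the boundary path space is either an infinite path or a finite path [w]
    with a terminal set [C] inside its range: a sink, a minimal sink, or a minimal
    infinite emitter.  It determines a filter in the semilattice of idempotents: over a
    beginning of the path followed by the edge [e], take the sets that contain the source
    of [e]; over the whole of a finite path, take the sets that contain [C] when [C] is a
    vertex, and almost all of [C] when [C] is infinite.  This map is a homeomorphism
    onto the tight spectrum which turns one shift into the other ([boundary_conjugacy]),
    and a conjugacy of partial maps induces an isomorphism of their Renault-Deaconu
    groupoids ([conjugacy_groupoid_iso]).

    Minimality of [C] means that each set of the Boolean ring contains almost all or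
    almost none of an infinite [C] ([carries_baseset]), so that the family taken over
    [w] is an ultrafilter of sets.  The filter of a boundary path is then maximal
    ([boundary_ultrafilter]) except when [C] is a vertex emitting infinitely many edges;
    in that case it is a limit of ultrafilters whose words continue [w] with ever new edges
    ([emitter_tight]).

    Conversely, two properties of ultrafilters involve finitely many elements of the
    semilattice at a time and therefore pass to their limits: a union belongs to the
    filter only if one of its members does ([tight_prime]), and over a regular vertex some
    edge continues the word ([tight_emit]).  The condition on the ranges of edges covers
    each set of the Boolean ring by finitely many vertices and infinite terminal
    sets, whence a tight filter with a longest word contains one of these over that word
    ([tight_terminal]); regular vertices being excluded, it is the filter of a
    boundary path ([tight_of_surj]).

    As for the topologies, the points whose filter contains a given idempotent form a
    clopen set of boundary paths ([near_cyl]), because the vertices of [C] on the wrong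
    side of a set are finite in number and emit finitely many edges ([terminal_split]);
    and each basic open set of boundary paths is given by finitely many such
    conditions ([DcylE], [DptE]). *)

(** * Continuity for the topologies given by subbases and by pointwise convergence *)

Lemma near_finite (T I : Type) (FF : set_system T) (D : set I) (P : I -> set T) :
  Filter FF -> finite_set D -> (forall i, D i -> FF (P i)) ->
  FF [set x | forall i, D i -> P i x].
Proof.
elim/Pchoice: I => I in D P *.
by move=> FFF /finite_fsetP[X ->] h; apply: filter_bigI => i /h.
Qed.

Section SubBase.
Variables (S T : topologicalType) (D : set (set T)).

(* This holds by conversion for a topology generated by the subbase [D]. *)
Hypothesis openD :
  @open T = [set \bigcup_(B in D') B | D' in subset^~ (finI_from D id)].

Lemma subbase_open A : D A -> open A.
Proof.
move=> DA; rewrite openD; exists [set A]; last by rewrite bigcup_set1.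
by move=> _ ->; exact: (finI_from1 id DA).
Qed.

Lemma subbase_continuous (f : S -> T) :
  (forall A, D A -> open (f @^-1` A)) -> continuous f.
Proof.
move=> oD; apply/continuousP => A; rewrite openD => -[D' sD' <-].
rewrite preimage_bigcup; apply: bigcup_open => B /sD'[F sF <-].
rewrite openE => x xF; apply: filter_bigI => A' FA'.
apply: (open_nbhs_nbhs); split; last exact: xF.
by apply: oD; apply/set_mem/sF.
Qed.
End SubBase.

Section Filters.
Variable G : ultragraph.
Local Notation ES := (ES G).
Local Notation filters := (filters G).
Local Notation tight_spectrum := (tight_spectrum G).

Lemma near_filter (xi : filters) (x : ES) :
  \forall F \near xi, filter_set F x <-> filter_set xi x.
Proof.
have c1 := @initial_continuous _ {ptws ES -> bool} (@charfun G) xi.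
have c2 := @proj_continuous _ (fun=> bool) x (charfun xi).
have c := @continuous_comp filters {ptws ES -> bool} bool (@charfun G) (proj x) xi c1 c2.
have n1 : nbhs (charfun xi x) [set charfun xi x] by apply/principal_filterP.
apply: (@filterS _ (nbhs xi) (nbhs_filter xi) _ _ _ (c _ n1)) => F /= e.
change (charfun F x = charfun xi x) in e.
split => Fx; first by have := asboolT Fx; rewrite -/(charfun F x) e => /asboolP.
by have := asboolT Fx; rewrite -/(charfun xi x) -e => /asboolP.
Qed.

Lemma cvg_filters (FF : set_system filters) (xi : filters) : Filter FF ->
  (forall x, \forall F \near FF, filter_set F x <-> filter_set xi x) ->
  FF --> xi.
Proof.
move=> FFF h A [_ /= [[B Bop <-] Bxi sBA]].
rewrite nbhs_filterE; apply: filterS sBA _.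
have : (@charfun G : filters -> {ptws ES -> bool}) @ FF --> charfun xi.
  apply/cvg_sup => x; apply/cvg_image.
    by rewrite eqEsubset; split => b // _; exists (fun=> b).
  move=> U /nbhs_singleton Uxi; rewrite /= nbhs_simpl.
  exists [set g : ES -> bool | U (g x)]; last first.
    by rewrite eqEsubset; split=> [_ [g Ug <-]//|b Ub]; exists (fun=> b).
  have := h x; apply: filterS => F /= e.
  by rewrite /charfun /proj (_ : `[< _ >] = charfun xi x)//; apply: asbool_equiv_eq.
by apply; rewrite nbhsE; exists B.
Qed.

Lemma cvg_tight (FF : set_system tight_spectrum) (xi : tight_spectrum) :
  Filter FF ->
  (forall x, \forall F \near FF, elts F x <-> elts xi x) -> FF --> xi.
Proof.
move=> FFF h A [_ /= [[B Bop <-] Bxi sBA]].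
rewrite nbhs_filterE; apply: filterS sBA _.
have : (set_val : _ -> filters) @ FF --> set_val xi by apply: cvg_filters => x; exact: h.
by apply; rewrite nbhsE; exists B.
Qed.

End Filters.

(** * Renault-Deaconu groupoids of conjugate partial maps *)

Section Conjugacy.
Local Open Scope ring_scope.

(** The maps [f] and [f'] stand for partial maps whose n-th powers have the domains [D n]
    and [D' n], so that they are compared only where they are defined. *)
Definition conjugacy (T T' : topologicalType) (D : nat -> set T) (D' : nat -> set T')
    (f : T -> T) (f' : T' -> T') (phi : T -> T') (psi : T' -> T) :=
  [/\ cancel phi psi /\ cancel psi phi, continuous phi /\ continuous psi,
      forall n x, D' n (phi x) <-> D n x,
      forall n x, D n.+1 x -> D n (f x) &
      forall n x, D n.+1 x -> f' (phi x) = phi (f x)].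

Lemma conjugacy_sym (T T' : topologicalType) D D' f f' phi psi :
  @conjugacy T T' D D' f f' phi psi -> @conjugacy T' T D' D f' f psi phi.
Proof.
move=> [[K K'] [cphi cpsi] DD fD ff]; split => //.
- by move=> n x; rewrite -[in D' n x](K' x); apply: iff_sym.
- by move=> n x; rewrite -[x]K' DD => xD; rewrite (ff n)// DD; apply: fD.
- by move=> n x; rewrite -{1}[x]K' DD => xD; rewrite -{2}[x]K' (ff n)// K.
Qed.

Section Transport.
Variables (T T' : topologicalType) (D : nat -> set T) (D' : nat -> set T').
Variables (f : T -> T) (f' : T' -> T') (phi : T -> T') (psi : T' -> T).
Hypothesis conj : conjugacy D D' f f' phi psi.

Lemma conjugacy_iter n x : D n x -> iter n f' (phi x) = phi (iter n f x).
Proof.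
case: conj => _ _ _ fD ff.
elim: n x => [//|n IHn] x xD.
by rewrite !iterSr (ff n)// IHn//; apply: fD.
Qed.

Lemma conjugacy_arrowP (g : rd_arrow D f) : exists m n,
  [/\ D' m (phi (rd_left g)), D' n (phi (rd_right g)),
      rd_deg g = m%:Z - n%:Z &
      iter m f' (phi (rd_left g)) = iter n f' (phi (rd_right g))].
Proof.
case: conj => _ _ DD _ _.
have [m [n [mD nD dE fE]]] := rd_arrowP g.
by exists m, n; split; rewrite ?DD// !conjugacy_iter// fE.
Qed.

Definition rd_map (g : rd_arrow D f) : rd_arrow D' f' :=
  RDArrow (conjugacy_arrowP g).

End Transport.

Lemma rd_arrow_eq (T : topologicalType) (D : nat -> set T) f (g h : rd_arrow D f) :
  rd_left g = rd_left h -> rd_deg g = rd_deg h -> rd_right g = rd_right h -> g = h.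
Proof.
case: g h => [x k y gP] [x' k' y' hP] /= ex ek ey; subst x' k' y'.
by congr RDArrow; apply: Prop_irrelevance.
Qed.

Lemma rd_mapK (T T' : topologicalType) D D' f f' phi psi
    (c : @conjugacy T T' D D' f f' phi psi) (c' : conjugacy D' D f' f psi phi) :
  cancel (rd_map c) (rd_map c').
Proof. by case: c c' => -[K ? ? ? ? ?] c' g; apply: rd_arrow_eq; rewrite //= K. Qed.

Lemma rd_map_continuous (T T' : topologicalType) D D' f f' phi psi
    (c : @conjugacy T T' D D' f f' phi psi) : continuous (rd_map c).
Proof.
apply: (subbase_continuous (D := @rd_basis T' D' f')) => // Z.
move=> [U [m [n [W [[oU UD] [oW WD] ->]]]]].
have [[K _] [cphi _] DD _ _] := c.
have pre k (A : set T') : A `<=` D' k -> phi @^-1` A `<=` D k.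
  by move=> AD x /AD; rewrite DD.
apply: (subbase_open (D := @rd_basis T D f)) => //.
exists (phi @^-1` U), m, n, (phi @^-1` W); split.
- by split; [apply: open_comp => // x _; apply: cphi|apply: pre].
- by split; [apply: open_comp => // x _; apply: cphi|apply: pre].
apply/seteqP; split => g [/= gU gW gd]; [|move=> e; split => //]; last first.
  by rewrite !(conjugacy_iter c) ?e//; apply: pre; eassumption.
rewrite !(conjugacy_iter c); [|exact: (pre _ _ WD)|exact: (pre _ _ UD)].
by move/(can_inj K).
Qed.

Lemma conjugacy_groupoid_iso (T T' : topologicalType) D D' f f' phi psi :
  @conjugacy T T' D D' f f' phi psi ->
  topological_groupoid_iso (rd_groupoid D f) (rd_groupoid D' f').
Proof.
move=> c; have c' := conjugacy_sym c.
exists (rd_map c), (rd_map c'); split.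
- by split; apply: rd_mapK.
- by split; apply: rd_map_continuous.
- have [[K _] _ _ _ _] := c; have inj := can_inj K.
  move=> g h k; split => -[/= e1 e2 e3 e4]; split => //=; rewrite ?e1 ?e2 ?e4 //.
  + exact: inj.
  + exact: inj.
  + exact: inj.
- by move=> g; apply: rd_arrow_eq.
Qed.

End Conjugacy.

(** * The sets carried by the ultrapaths of the boundary *)

Section Sets.
Variable G : ultragraph.
Local Notation V := (vertex G).
Local Notation E := (edge G).
Implicit Types (A B C : set V) (v : V) (e : E).

Lemma genvert_closed : setU_closed (@genvert G) /\ setI_closed (@genvert G).
Proof.
by split=> A B gA gB M MP; have [[MU MI] _] := MP; [apply: MU|apply: MI];
  do [exact: (gA _ MP)|exact: (gB _ MP)].
Qed.

Lemma genvert1 v : genvert [set v].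
Proof. by apply: sub_gen_smallest; left; right; exists v. Qed.

Lemma genvert_rng e : genvert (rng e).
Proof. by apply: sub_gen_smallest; right; exists e. Qed.

Lemma baseset1 v : baseset [set v].
Proof. exact: (baseset_genvert (genvert1 v)). Qed.

Lemma basesetD A B : baseset A -> baseset B -> baseset (A `\` B).
Proof.
move=> bA bB M MP; have [[MD _ _] _] := MP.
by apply: MD; [exact: (bA _ MP)|exact: (bB _ MP)].
Qed.

Lemma basesetU A B : baseset A -> baseset B -> baseset (A `|` B).
Proof.
move=> bA bB M MP; have [[_ MU _] _] := MP.
by apply: MU; [exact: (bA _ MP)|exact: (bB _ MP)].
Qed.

Lemma baseset_ind (P : set V -> Prop) :
  (forall A, genvert A -> P A) ->
  (forall A B, baseset A -> baseset B -> P A -> P B ->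
    [/\ P (A `\` B), P (A `|` B) & P (A `&` B)]) ->
  forall A, baseset A -> P A.
Proof.
move=> Pg PB A bA.
suff [] : baseset A /\ P A by [].
apply: (bA [set B | baseset B /\ P B]); split; last first.
  by move=> B gB; split; [apply: baseset_genvert|apply: Pg].
split=> B C [bB hB] [bC hC]; have [? ? ?] := PB _ _ bB bC hB hC; split=> //.
- exact: basesetD.
- exact: basesetU.
- exact: basesetI.
Qed.

Lemma genvert_ind (P : set V -> Prop) :
  P set0 -> (forall v, P [set v]) -> (forall e, P (rng e)) ->
  (forall A B, genvert A -> genvert B -> P A -> P B ->
    P (A `|` B) /\ P (A `&` B)) ->
  forall A, genvert A -> P A.
Proof.
move=> P0 P1 Pr PB A gA.
suff [] : genvert A /\ P A by [].
have [gU gI] := genvert_closed.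
apply: (gA [set B | genvert B /\ P B]); split.
  by split=> B C [gB hB] [gC hC]; have [? ?] := PB _ _ gB gC hB hC; split=> //;
    [apply: gU|apply: gI].
move=> B hB; split; first by apply: sub_gen_smallest.
by case: hB => [[->//|[v _ <-]]|[e _ <-]].
Qed.

(** The sets that end the finite elements of the boundary path space. *)
Definition terminal C :=
  [\/ min_inf_emitter C, exists2 v, is_sink v & C = [set v] | min_sink C].

Lemma in_XfinE x : in_Xfin x <-> ultrapath x /\ terminal x.2.
Proof.
split=> [[[? ?]|[? [?|?]]]|[ux [|?|?]]].
- by split => //; constructor 1.
- by split => //; constructor 2.
- by split => //; constructor 3.
- by left.
- by right; split => //; left.
- by right; split => //; right.
Qed.

Lemma terminal_genvert C : terminal C -> genvert C.
Proof. by case=> [[]|[v _ ->]|[]] //; exact: genvert1. Qed.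

Lemma terminal_baseset C : terminal C -> baseset C.
Proof. by move=> tC; exact: (baseset_genvert (terminal_genvert tC)). Qed.

Lemma emits0 : emits (@set0 V) = set0.
Proof. by apply/seteqP; split. Qed.

Lemma emitsE A : emits A = \bigcup_(v in A) emits [set v].
Proof.
apply/seteqP; split=> [e Ae|e [v Av /= ev]]; first by exists (src e).
by rewrite /emits /= ev.
Qed.

Lemma subset_emits A B : A `<=` B -> emits A `<=` emits B.
Proof. by move=> AB e /AB. Qed.

Lemma proper1 v C : C v -> C <> [set v] -> [set v] `<` C.
Proof.
move=> Cv CNv; split=> [_ ->//|sC]; apply: CNv.
by apply/seteqP; split=> // _ ->.
Qed.

Lemma terminal1 v : terminal [set v] <-> ~ is_regular v.
Proof.
split=> [|nreg].
  case=> [[_ Ninf _] [_ /Ninf//]|[w sw e] [[x xv] _]|[_ /(_ (finite_set1 _))//]].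
  have : emits [set w] x by rewrite -e.
  by rewrite sw.
case: (pselect (finite_set (emits [set v]))) => [fin|inf].
  constructor 2; exists v => //; apply/eqP; apply: contra_notT nreg => /set0P.
  by split.
constructor 1; split=> [|//|C _]; first exact: genvert1.
move=> [Cv vNC]; have -> : C = set0.
  apply/seteqP; split=> // x Cx; apply: vNC => _ ->.
  by have <- : x = v := Cv _ Cx.
by rewrite emits0; split=> [|[_]]; exact.
Qed.

(** A finite set emitting infinitely many edges contains a vertex that does; the
    singleton of this vertex is an infinite emitter, hence the whole set by minimality. *)
Lemma terminal_finite C : terminal C -> finite_set C -> exists v, C = [set v].
Proof.
case=> [[gC infC minC] finC|[v _ ->]|[_ + _ _]//]; last by exists v.
have [v Cv infv] : exists2 v, C v & infinite_set (emits [set v]).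
  apply: contra_notP infC => allfin; rewrite emitsE; apply: bigcup_finite => // v Cv.
  by apply: contra_notP allfin => ?; exists v.
exists v; apply: contra_notP infv => CNv.
by have [/contrapT] := minC _ (genvert1 v) (proper1 Cv CNv).
Qed.

Lemma terminal_neq0 C : terminal C -> C !=set0.
Proof.
case=> [[_ inf _]|[v _ ->]|[_ /infinite_setN0 inf _ _]]//; last by exists v.
by apply/set0P; apply: contra_notN inf => /eqP ->; rewrite emits0.
Qed.

(** By minimality the vertices of an infinite terminal set are not infinite emitters. *)
Lemma terminal_emits v C :
  terminal C -> infinite_set C -> C v -> finite_set (emits [set v]).
Proof.
case=> [[gC infC minC] iC Cv|[w _ ->]|[_ _ fC _] _ Cv]; last first.
- by apply: sub_finite_set fC => e; rewrite /emits /= => ->.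
- by move=> /(_ (finite_set1 _)).
have CNv : C <> [set v] by move=> e; apply: iC; rewrite e.
by have [/contrapT] := minC _ (genvert1 v) (proper1 Cv CNv).
Qed.

Lemma terminal_emits_finite C A : terminal C -> infinite_set C -> A `<=` C ->
  finite_set A -> finite_set (emits A).
Proof.
move=> tC iC AC fA; rewrite emitsE; apply: bigcup_finite => // v /AC.
exact: terminal_emits.
Qed.

(** When [A] misses a vertex of [C], minimality applies to [C `&` A], a proper subset that
    belongs to the generated family. *)
Lemma terminal_genvertP C A : terminal C -> infinite_set C -> genvert A ->
  C `<=` A \/ finite_set (C `&` A).
Proof.
move=> tC iC gA; case: (pselect (C `<=` A)) => CA; [by left|right].
have pr : C `&` A `<` C by split=> [x []//|sC]; apply: CA => x /sC[].
have gCA : genvert (C `&` A).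
  by apply: genvert_closed.2 => //; exact: terminal_genvert.
case: tC => [[_ _ /(_ _ gCA pr)[fe]]|[v _ e]|[_ _ _ /(_ _ gCA pr)/contrapT//]].
  by move=> nf; apply: contrapT => ifC; apply: nf; split=> //; exact: contrapT.
by move: iC; rewrite e => /(_ (finite_set1 _)).
Qed.

(** The filter of [C]: principal when [C] is a vertex, and else that of the
    sets containing almost all of [C]. *)
Definition carries C A := C `<=` A \/ (infinite_set C /\ finite_set (C `\` A)).

Lemma carries1 v A : carries [set v] A <-> A v.
Proof.
split=> [[/(_ v erefl)//|[/(_ (finite_set1 _))//]]|Av].
by left=> _ ->.
Qed.

Lemma carriesS C A B : A `<=` B -> carries C A -> carries C B.
Proof.
move=> AB [CA|[iC fC]]; [left; exact: subset_trans CA AB|right; split=> //].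
by apply: sub_finite_set fC => x [Cx Bx]; split=> // /AB.
Qed.

Lemma carriesI C A B : carries C A -> carries C B -> carries C (A `&` B).
Proof.
move=> [CA|[iC fA]] [CB|[iC' fB]].
- by left=> x Cx; split; [apply: CA|apply: CB].
- by right; split=> //; apply: sub_finite_set fB => x [Cx h]; split=> // Bx; apply: h;
    split=> //; apply: CA.
- by right; split=> //; apply: sub_finite_set fA => x [Cx h]; split=> // Bx; apply: h;
    split=> //; apply: CB.
- by right; rewrite setDIr; split=> //; rewrite finite_setU.
Qed.

Lemma carries_meet C A : terminal C -> carries C A -> C `&` A !=set0.
Proof.
move=> tC [CA|[iC fCA]].
  by have [x Cx] := terminal_neq0 tC; exists x; split=> //; apply: CA.
apply/set0P; apply/eqP => e; apply: iC.
by have := setUIDK C A; rewrite e set0U => <-.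
Qed.

(** The sets that cut [C] into a finite and a cofinite part form a Boolean ring. *)
Lemma carries_baseset C A : terminal C -> baseset A ->
  carries C A \/ carries C (~` A).
Proof.
move=> tC bA; case: (pselect (finite_set C)) => [fC|iC].
  have [v ->] := terminal_finite tC fC; rewrite !carries1; exact: EM.
suff [] : finite_set (C `\` A) \/ finite_set (C `&` A).
- by left; right.
- by right; right; rewrite setDE setCK.
elim/baseset_ind: A / bA => [A gA|A B _ _ hA hB]; last split.
- case: (terminal_genvertP tC iC gA); [|by right].
  by left; have -> : C `\` A = set0 by rewrite setD_eq0.
- case: hA => fA; last by right; apply: sub_finite_set fA => x [? []].
  case: hB => fB; first by right; apply: sub_finite_set fB => x [? []].
  left; apply: sub_finite_set (_ : finite_set ((C `\` A) `|` (C `&` B))); last first.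
    by rewrite finite_setU.
  by move=> x [Cx nx]; case: (pselect (A x)) => Ax; [right|left]; split=> //;
    apply: contrapT => nB; apply: nx.
- case: hA => fA; first by left; apply: sub_finite_set fA => x [? h]; split=> // ?; apply: h; left.
  case: hB => fB; first by left; apply: sub_finite_set fB => x [? h]; split=> // ?; apply: h; right.
  by right; rewrite setIUr finite_setU.
- case: hA => fA; last by right; apply: sub_finite_set fA => x [? []].
  case: hB => fB; last by right; apply: sub_finite_set fB => x [? []].
  by left; rewrite setDIr finite_setU.
Qed.

Lemma carriesNC C A : terminal C -> carries C A -> ~ carries C (~` A).
Proof.
move=> tC cA /(carriesI cA)/(carries_meet tC)[x].
by rewrite setICr => -[].
Qed.

(** [T] collects the vertices of [C] on the wrong side of [A]; they emit finitely many
    edges in total, so that they may be removed from a neighborhood of [C]. *)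
Lemma terminal_split C A : terminal C -> baseset A -> exists T,
  [/\ T `<=` C, finite_set T, finite_set (emits T) &
      forall v, C v -> ~ T v -> (A v <-> carries C A)].
Proof.
move=> tC bA; case: (pselect (finite_set C)) => [fC|iC].
  have [v ->] := terminal_finite tC fC; exists set0; split; rewrite ?emits0 //.
  by move=> _ -> _; rewrite carries1.
have small T : T `<=` C -> finite_set T -> finite_set (emits T).
  exact: terminal_emits_finite.
have [cA|cA] := carries_baseset tC bA.
  have f : finite_set (C `\` A).
    case: cA => [|[]//] CA.
    by have -> : C `\` A = set0 by rewrite setD_eq0.
  exists (C `\` A); split=> //; first by apply: small => // x [].
  move=> v Cv nv; split=> // _; apply: contrapT => nA; exact: nv.
have f : finite_set (C `&` A).
  case: cA => [CA|[]]; last by rewrite setDE setCK.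
  by rewrite (_ : C `&` A = set0)//; apply/seteqP; split=> // x [/CA].
exists (C `&` A); split=> //; first by apply: small => // x [].
move=> v Cv nv; split=> [Av|cA']; first by case: nv.
by case: (carriesNC tC cA' cA).
Qed.

Lemma carries_genvert C A : terminal C -> genvert A -> carries C A -> C `<=` A.
Proof.
move=> tC gA [//|[iC fC]].
case: (terminal_genvertP tC iC gA) => // fI.
by case: iC; rewrite -(setUIDK C A) finite_setU.
Qed.

Lemma terminal_sub_eq C C' : terminal C -> terminal C' -> infinite_set C ->
  C `<=` C' -> C = C'.
Proof.
move=> tC tC' iC CC'.
have iC' : infinite_set C' by apply: sub_infinite_set iC.
case: (terminal_genvertP tC' iC' (terminal_genvert tC)) => [?|f].
  by apply/seteqP.
by case: iC; apply: sub_finite_set f => x Cx; split=> //; apply: CC'.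
Qed.

(** Members of the generated family that contain almost all of [C] contain [C], so that
    a terminal set is recovered from its filter. *)
Lemma carries_inj C C' : terminal C -> terminal C' ->
  carries C C' -> carries C' C -> C = C'.
Proof.
move=> tC tC' c c'; apply/seteqP; split; apply: carries_genvert => //;
  exact: terminal_genvert.
Qed.

End Sets.

(** * The semilattice of idempotents and its filters *)

Section SemilatticeFilters.
Variable G : ultragraph.
Local Notation V := (vertex G).
Local Notation E := (edge G).
Local Notation ES := (ES G).
Implicit Types (A B C : set V) (v : V) (e : E) (w u : seq E) (F : set ES).

Lemma cat_cons_eq w w' u u' e f : w ++ e :: u = w' ++ f :: u' ->
  [\/ w = w' /\ e = f, exists t, w' = w ++ e :: t | exists t, w = w' ++ f :: t].
Proof.
elim: w w' => [|a w IHw] [|b w'] /= [].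
- by move=> -> _; constructor 1.
- by move=> -> _; constructor 2; exists w'.
- by move=> -> _; constructor 3; exists w.
- move=> -> /IHw[[-> ->]|[t ->]|[t ->]].
  + by constructor 1.
  + by constructor 2; exists t.
  + by constructor 3; exists t.
Qed.

Lemma range_of_cat w e u : range_of (w ++ e :: u) = rng (last e u).
Proof. by case: w => [//|a w] /=; rewrite last_cat. Qed.

Lemma is_path_catl w u : is_path (w ++ u) -> @is_path G w.
Proof. by case: w => [//|a w]; rewrite /is_path /= cat_path => /andP[]. Qed.

Lemma is_path_src w e u : is_path (w ++ e :: u) -> range_of w (src e).
Proof.
case: w => [//|a w]; rewrite /is_path /= cat_path /= => /and3P[_ + _].
by rewrite inE.
Qed.

Lemma is_path_rcons w e : is_path w -> range_of w (src e) -> @is_path G (rcons w e).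
Proof.
case: w => [//|a w]; rewrite /is_path /= rcons_path => ->; exact: mem_set.
Qed.

Lemma idem_eq (p q : idem G) : iword p = iword q -> iset p = iset q -> p = q.
Proof.
case: p q => [w A h1 h2 h3 h4] [w' A' h1' h2' h3' h4'] /= ew eA; subst w' A'.
by congr Idem; apply: Prop_irrelevance.
Qed.

Lemma cutP C (hC : baseset C) (p q : idem G) :
  cut hC p = Some q <-> iword q = iword p /\ iset q = C `&` iset p.
Proof.
rewrite /cut; case: pselect => [h|n]; split=> //.
- by move=> [<-].
- by move=> [ew eA]; congr Some; apply: idem_eq.
- by move=> [_ e]; case: n; rewrite -e; exact: iset_neq0.
Qed.

(** The order reduces to inclusion over equal words, and to the source of the next edge
    over a longer word. *)
Lemma ESleP (p q : idem G) : ESle (Some p) (Some q) <->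
  (iword p = iword q /\ iset p `<=` iset q) \/
  (exists e u, iword p = iword q ++ e :: u /\ iset q (src e)).
Proof.
rewrite /ESle /ESmul; split.
  case: ifP => [pq|npq].
    move=> /cutP[ew]; rewrite ew drop_size /= => ->.
    by left; split=> // x [].
  case: ifP => [/prefixP[[|e u] ew]|//] /cutP[_].
    by rewrite ew cats0 prefix_refl in npq.
  rewrite ew drop_size_cat//= => eA; right; exists e, u; split=> //.
  case: ifP eA => [|_ e0]; first by rewrite inE.
  by have [x] := iset_neq0 p; rewrite e0 => -[].
move=> [[ew sA]|[e [u [ew Ae]]]].
  rewrite ew prefix_refl; apply/cutP; split=> //.
  by rewrite drop_size /=; apply/seteqP; split=> [x px|x []//]; split=> //; apply: sA.
have -> : prefix (iword p) (iword q) = false.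
  apply/negP => /size_prefix; rewrite ew size_cat /= addnS.
  by rewrite leqNgt ltnS leq_addr.
rewrite ew prefix_prefix; apply/cutP; split=> //.
rewrite drop_size_cat//= mem_set//.
apply/seteqP; split=> [x px|x []//]; split=> //.
by rewrite -(range_of_cat (iword q)) -ew; exact: (@iset_sub _ p).
Qed.

Lemma ESle_refl (x : ES) : ESle x x.
Proof. by case: x => [p|]; last exact: erefl; apply/ESleP; left; split. Qed.

Lemma ESle_None (x : ES) : ESle x None -> x = None.
Proof. by case: x => [p|//] /(@esym ES). Qed.

Lemma ESle_trans (y x z : ES) : ESle x y -> ESle y z -> ESle x z.
Proof.
case: x => [p|]; last by [].
case: y => [q|]; last by move=> /ESle_None.
case: z => [r|]; last by move=> _ /ESle_None.
move=> /ESleP pq /ESleP qr; apply/ESleP.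
case: pq => [[-> pq]|[e [u [-> qe]]]]; case: qr => [[eqr qr]|[f [t [eqr rf]]]].
- by left; split=> //; exact: subset_trans qr.
- by right; exists f, t.
- by right; exists e, u; rewrite eqr; split=> //; exact: qr.
- by right; exists f, (t ++ e :: u); rewrite eqr -catA.
Qed.

Lemma ES_glb (x y : ES) : exists m, [/\ ESle m x, ESle m y &
  forall t, ESle t x -> ESle t y -> ESle t m].
Proof.
case: x => [p|]; last by exists None.
case: y => [q|]; last by exists None.
case: (pselect (ESle (Some p) (Some q))) => pq.
  by exists (Some p); split=> //; exact: ESle_refl.
case: (pselect (ESle (Some q) (Some p))) => qp.
  by exists (Some q); split=> //; exact: ESle_refl.
case: (pselect (iword p = iword q /\ iset p `&` iset q !=set0)) => [[ew h]|n].
  pose m := Idem (iwordP p) h (basesetI (iset_base p) (iset_base q))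
    (fun x hx => @iset_sub _ p x hx.1).
  exists (Some m); split; first by apply/ESleP; left; split=> // z [].
    by apply/ESleP; left; split=> // z [].
  case=> [t|//] /ESleP tp /ESleP tq; apply/ESleP.
  case: tp => [[et tp]|[e [u [et pe]]]]; case: tq => [[et' tq]|[f [s [et' qf]]]].
  - by left; split=> // z tz; split; [apply: tp|apply: tq].
  - move: et'; rewrite et ew => /(congr1 size); rewrite size_cat /= addnS.
    by move/eqP; rewrite -addnS -{1}[size _]addn0 eqn_add2l.
  - move: et; rewrite et' ew => /(congr1 size); rewrite size_cat /= addnS.
    by move/eqP; rewrite -addnS -{1}[size _]addn0 eqn_add2l.
  - right; exists e, u; split=> //; split=> //.
    move: et'; rewrite et ew => /eqP; rewrite eqseq_cat// eqxx /= => /eqP[-> _].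
    exact: qf.
exists None; split=> // -[t|//] /ESleP tp /ESleP tq; exfalso.
case: tp => [[et tp]|[e [u [et pe]]]]; case: tq => [[et' tq]|[f [s [et' qf]]]].
- apply: n; split; first by rewrite -et.
  by have [z tz] := iset_neq0 t; exists z; split; [apply: tp|apply: tq].
- by apply: pq; apply/ESleP; right; exists f, s; rewrite -et.
- by apply: qp; apply/ESleP; right; exists e, u; rewrite -et'.
- move: et'; rewrite et => /cat_cons_eq[[ew ef]|[r er]|[r er]].
  + by apply: n; split=> //; exists (src e); split=> //; rewrite ef.
  + by apply: qp; apply/ESleP; right; exists e, r.
  + by apply: pq; apply/ESleP; right; exists f, r.
Qed.

(** This is [level], for filters that need not be tight. *)
Definition lev F w : set (set V) :=
  [set A | exists2 p, F (Some p) & iword p = w /\ iset p = A].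

(** The conditions making (w, A, w) a nonzero idempotent. *)
Definition valid w A := [/\ @is_path G w, A !=set0, baseset A & A `<=` range_of w].

Lemma valid_idem w A : valid w A -> exists p : idem G, iword p = w /\ iset p = A.
Proof. by move=> [h1 h2 h3 h4]; exists (Idem h1 h2 h3 h4). Qed.

Lemma lev_valid F w A : lev F w A -> valid w A.
Proof.
move=> [p _ [<- <-]]; split; [exact: iwordP|exact: iset_neq0|exact: iset_base|].
exact: (@iset_sub _ p).
Qed.

Lemma levE F (p : idem G) : lev F (iword p) (iset p) <-> F (Some p).
Proof.
split=> [[q Fq [ew eA]]|Fp]; last by exists p.
by rewrite -(idem_eq ew eA).
Qed.

Lemma lev_ext F F' : ~ F None -> ~ F' None ->
  (forall w A, valid w A -> (lev F w A <-> lev F' w A)) -> F = F'.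
Proof.
move=> n n' e; apply/seteqP; split=> -[p|//] /levE Fp; apply/levE; apply/e => //;
  exact: lev_valid Fp.
Qed.

Section Filter.
Variable F : set ES.
Hypothesis filF : is_filter F.

Lemma lev_up w A B : baseset B -> B `<=` range_of w -> A `<=` B ->
  lev F w A -> lev F w B.
Proof.
move=> bB Bw AB LA; have [pw nA _ _] := lev_valid LA.
have [q [qw qB]] : exists q : idem G, iword q = w /\ iset q = B.
  by apply: valid_idem; split=> //; exact: subset_nonempty nA.
case: LA => p Fp [ew eA]; exists q => //; have [_ _ up _] := filF.
by apply: up Fp _; apply/ESleP; left; rewrite ew qw eA qB.
Qed.

Lemma lev_beginning w e u A B : baseset B -> B `<=` range_of w -> B (src e) ->
  lev F (w ++ e :: u) A -> lev F w B.
Proof.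
move=> bB Bw Be LA; have [/is_path_catl pw _ _ _] := lev_valid LA.
have [q [qw qB]] : exists q : idem G, iword q = w /\ iset q = B.
  by apply: valid_idem; split=> //; exists (src e).
case: LA => p Fp [ew eA]; exists q => //; have [_ _ up _] := filF.
by apply: up Fp _; apply/ESleP; right; exists e, u; rewrite ew qw qB.
Qed.

Lemma lev_vertex w e u A : lev F (w ++ e :: u) A -> lev F w [set src e].
Proof.
move=> LA; have [pw _ _ _] := lev_valid LA.
apply: lev_beginning LA => //; first exact: baseset1.
by move=> _ ->; exact: is_path_src pw.
Qed.

Lemma lev_meet w w' A B : lev F w A -> lev F w' B -> exists w'' C, [/\ lev F w'' C,
    (w'' = w /\ C `<=` A) \/ (exists e u, w'' = w ++ e :: u /\ A (src e)) &
    (w'' = w' /\ C `<=` B) \/ (exists e u, w'' = w' ++ e :: u /\ B (src e))].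
Proof.
move=> [p Fp [<- <-]] [q Fq [<- <-]]; have [_ n0 _ dir] := filF.
have [[r|] [Fr rp rq]] := dir _ _ Fp Fq; last by [].
move/ESleP: rp => rp; move/ESleP: rq => rq.
by exists (iword r), (iset r); split=> //; apply/levE.
Qed.

Lemma lev_setI w A B : lev F w A -> lev F w B -> lev F w (A `&` B).
Proof.
move=> LA LB; have [_ _ bA Aw] := lev_valid LA; have [_ _ bB _] := lev_valid LB.
have bAB := basesetI bA bB; have ABw : A `&` B `<=` range_of w by move=> x [/Aw].
have [w'' [C [LC]]] := lev_meet LA LB.
case=> [[ew CA]|[e [u [ew Ae]]]] [[ew' CB]|[f [s [ew' Bf]]]]; subst w''.
- by apply: lev_up LC => // x Cx; split; [apply: CA|apply: CB].
- move: ew' => /(congr1 size); rewrite size_cat /= addnS.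
  by move/eqP; rewrite -addnS -{1}[size _]addn0 eqn_add2l.
- move: ew' => /(congr1 size); rewrite size_cat /= addnS.
  by move/eqP; rewrite -addnS -{2}[size _]addn0 eqn_add2l.
- apply: lev_beginning LC => //; split=> //.
  by move: ew' => /eqP; rewrite eqseq_cat// eqxx /= => /eqP[-> _].
Qed.

(** Two members of a filter have a nonzero lower bound, which makes their words
    comparable. *)
Lemma lev_compat w w' A B : lev F w A -> lev F w' B ->
  [\/ w = w', exists e u, w' = w ++ e :: u /\ A (src e) |
      exists e u, w = w' ++ e :: u /\ B (src e)].
Proof.
move=> LA LB; have [w'' [C [LC]]] := lev_meet LA LB.
case=> [[ew CA]|[e [u [ew Ae]]]] [[ew' CB]|[f [s [ew' Bf]]]].
- by constructor 1; rewrite -ew.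
- by constructor 3; exists f, s; rewrite -ew.
- by constructor 2; exists e, u; rewrite -ew'.
- move: ew'; rewrite ew => /cat_cons_eq[[ew' _]|[t et]|[t et]].
  + by constructor 1.
  + by constructor 2; exists e, t.
  + by constructor 3; exists f, t.
Qed.

End Filter.

(** If every [z] in [F] had a nonzero lower bound with [x], then the elements above some
    meet of [x] and [z] would form a filter larger than [F]. *)
Lemma ultra_incompatible F x : is_ultrafilter F -> ~ F x ->
  exists2 z, F z & forall t, ESle t z -> ESle t x -> t = None.
Proof.
move=> [[[z0 Fz0] n0 up dir] maxF]; apply: contra_notP => no.
have compat z : F z -> exists t, [/\ ESle t z, ESle t x & t <> None].
  move=> Fz; apply: contra_notP no => none; exists z => // t tz tx.
  by apply: contrapT => t0; apply: none; exists t.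
pose F' := [set y | exists2 z, F z & forall t, ESle t z -> ESle t x -> ESle t y].
have FF' : F `<=` F' by move=> z Fz; exists z.
suff filF' : is_filter F' by rewrite -(maxF _ filF' FF'); exists z0.
split.
- by exists z0; apply: FF'.
- move=> [z Fz h]; have [t [tz tx t0]] := compat z Fz.
  by apply: t0; apply: ESle_None; apply: h.
- move=> y y' [z Fz h] yy'; exists z => // t tz tx.
  by apply: ESle_trans yy'; apply: h.
- move=> y y' [z Fz h] [z' Fz' h']; have [r [Fr rz rz']] := dir _ _ Fz Fz'.
  have [m [mr mx glb]] := ES_glb r x; exists m; split.
  + by exists r => // t tr tx; apply: glb.
  + by apply: h => //; apply: ESle_trans rz.
  + by apply: h' => //; apply: ESle_trans rz'.
Qed.

Lemma ultrafilter_ext F0 : is_filter F0 ->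
  exists2 F, is_ultrafilter F & F0 `<=` F.
Proof.
move=> fil0; have [[x0 F0x] n0 up0 dir0] := fil0.
have [Z [filZ maxZ]] : exists Z, is_filter (F0 `|` Z) /\
    forall Z', Z `<` Z' -> ~ is_filter (F0 `|` Z').
  (* Zorn's lemma is applied to what is added to [F0], the empty chain having the
     empty set as its union. *)
  apply: (@Zorn_bigcup _ [set Z | is_filter (F0 `|` Z)]) => K KP totK.
  case: (pselect (K !=set0)) => [[Z0 KZ0]|K0]; last first.
    rewrite /= (_ : \bigcup_(X in K) X = set0) ?setU0//.
    by apply/seteqP; split=> // x [Z KZ _]; apply: K0; exists Z.
  have inK x : (F0 `|` \bigcup_(X in K) X) x -> exists2 Z, K Z & (F0 `|` Z) x.
    by move=> [F0x'|[Z KZ Zx]]; [exists Z0 => //; left|exists Z => //; right].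
  have subK Z x : K Z -> (F0 `|` Z) x -> (F0 `|` \bigcup_(X in K) X) x.
    by move=> KZ [|Zx]; [left|right; exists Z].
  split.
  - by exists x0; left.
  - by move=> /inK[Z KZ]; have [_ n _ _] := KP _ KZ; exact: n.
  - move=> x y /inK[Z KZ Zx] xy; apply: (subK Z) => //.
    by have [_ _ up _] := KP _ KZ; exact: up Zx xy.
  - move=> x y /inK[Z KZ Zx] /inK[Z' KZ' Zy].
    have [W [KW Wx Wy]] : exists W, [/\ K W, (F0 `|` W) x & (F0 `|` W) y].
      by have [ZZ|ZZ] := totK _ _ KZ KZ'; [exists Z'|exists Z]; split=> //;
        apply: setUS ZZ _ _.
    have [_ _ _ dir] := KP _ KW; have [z [Wz zx zy]] := dir _ _ Wx Wy.
    by exists z; split=> //; apply: subK Wz.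
exists (F0 `|` Z); last by left.
split=> // F filF ZF; apply/seteqP; split=> // x Fx; apply: contrapT => nx.
have eF : F0 `|` F = F by rewrite setUidr// => y F0y; apply: ZF; left.
apply: (maxZ F); last by rewrite eF.
split=> [y Zy|FZ]; first by apply: ZF; right.
by apply: nx; right; apply: FZ.
Qed.

End SemilatticeFilters.

(** * Tight filters *)

Section Tight.
Variable G : ultragraph.
Local Notation V := (vertex G).
Local Notation E := (edge G).
Local Notation ES := (ES G).
Implicit Types (A B C : set V) (v : V) (e : E) (w u : seq E) (F : set ES).
Implicit Types (xi : tight_spectrum G).

(** If [F] avoided both [A] and [B] over [w], some element of [F] would be incompatible
    with both.  A nonzero lower bound of this element and (w, A `|` B, w) either
    has [w] as its word and meets [A] or [B], or continues [w] by an edge starting in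
    [A] or [B], contrary to the incompatibility. *)
Lemma ultra_prime F w A B : is_ultrafilter F -> baseset A -> baseset B ->
  lev F w (A `|` B) -> lev F w A \/ lev F w B.
Proof.
move=> uF bA bB LAB; apply: contrapT => /not_orP[nA nB].
have [filF _] := uF; have [_ n0 _ dir] := filF.
have [pw _ _ sAB] := lev_valid LAB.
have key C : baseset C -> C `<=` A `|` B -> ~ lev F w C ->
    exists2 z, F z & forall p, ESle (Some p) z ->
     ~ ((iword p = w /\ iset p `&` C !=set0) \/
        exists e u, iword p = w ++ e :: u /\ C (src e)).
  move=> bC CAB nC.
  have Cw : C `<=` range_of w by exact: subset_trans sAB.
  case: (pselect (C !=set0)) => [C0|C0]; last first.
    have [p Fp _] := LAB; exists (Some p) => // q _ [[_ [x [_ Cx]]]|[e [u [_ Ce]]]].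
      by apply: C0; exists x.
    by apply: C0; exists (src e).
  have [c [cw cC]] : exists p : idem G, iword p = w /\ iset p = C by exact: valid_idem.
  have nc : ~ F (Some c) by move=> Fc; apply: nC; exists c.
  have [z Fz inc] := ultra_incompatible uF nc; exists z => // p pz.
  case=> [[ew h]|[e [u [ew Ce]]]].
    have [q [qw qA]] : exists q : idem G, iword q = w /\ iset q = iset p `&` C.
      apply: valid_idem; split=> //; first exact: basesetI (iset_base p) bC.
      by move=> x [_ /Cw].
    suff : Some q = None by [].
    apply: inc.
      apply: ESle_trans pz; apply/ESleP; left; rewrite qw ew qA; by split.
    by apply/ESleP; left; rewrite qw cw qA cC; split.
  suff : Some p = None by [].
  by apply: inc => //; apply/ESleP; right; exists e, u; rewrite ew cw cC.
have [z Fz hz] := key _ bA (@subsetUl _ _ _) nA.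
have [z' Fz' hz'] := key _ bB (@subsetUr _ _ _) nB.
have [y [Fy yz yz']] := dir _ _ Fz Fz'.
have [p0 Fp0 [p0w p0A]] := LAB.
have [[r|] [Fr ry rp]] := dir _ _ Fy Fp0; last by [].
have rz := ESle_trans ry yz; have rz' := ESle_trans ry yz'.
move/ESleP: rp; rewrite p0w p0A => -[[ew rAB]|[e [u [ew [Ae|Be]]]]].
- have [x rx] := iset_neq0 r; case: (rAB x rx) => h.
    by apply: (hz _ rz); left; split=> //; exists x.
  by apply: (hz' _ rz'); left; split=> //; exists x.
- by apply: (hz _ rz); right; exists e, u.
- by apply: (hz' _ rz'); right; exists e, u.
Qed.

(** An element of the filter below (w, [set src e], w) either has a longer word, whose
    next edge is the one sought, or it is that idempotent itself, which is compatible
    with the continuation of [w] by [e]. *)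
Lemma ultra_emit F w e : is_ultrafilter F -> lev F w [set src e] ->
  exists2 f, src f = src e & lev F (rcons w f) (rng f).
Proof.
move=> uF Lv; have [filF _] := uF; have [_ n0 _ dir] := filF.
have [pw _ _ sv] := lev_valid Lv.
have sve := sv _ erefl.
have [c [cw cC]] : exists p : idem G, iword p = rcons w e /\ iset p = rng e.
  apply: valid_idem; split.
  - exact: is_path_rcons.
  - exact: rng_neq0.
  - exact: baseset_rng.
  - by rewrite -cats1 range_of_cat.
case: (pselect (F (Some c))) => [Fc|nc]; first by exists e => //; exists c.
have [z Fz inc] := ultra_incompatible uF nc.
have [p0 Fp0 [p0w p0A]] := Lv.
have [[r|] [Fr rz rp]] := dir _ _ Fz Fp0; last by [].
have [[ew rv]|[f [u [ew]]]] : (iword r = w /\ iset r `<=` [set src e]) \/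
    exists f u, iword r = w ++ f :: u /\ [set src e] (src f).
- by move/ESleP: rp; rewrite p0w p0A.
- suff : Some c = None by [].
  apply: inc; last exact: ESle_refl.
  apply: ESle_trans rz; apply/ESleP; right; exists e, [::].
  rewrite cw ew cats1; split=> //.
  by have [x rx] := iset_neq0 r; rewrite -(rv x rx).
- move=> /= fe; exists f => //.
  have Lr : lev F (iword r) (iset r) by exists r.
  have [pr _ _ rr] := lev_valid Lr.
  have pwf : is_path (rcons w f) by move: pr; rewrite ew -cat_rcons => /is_path_catl.
  have rf : rng f `<=` range_of (rcons w f) by rewrite -cats1 range_of_cat.
  case: u ew => [|a u] ew.
    rewrite ew cats1 in Lr rr.
    apply: (lev_up filF) Lr => //; first exact: baseset_rng.
    by move: rr; rewrite -cats1 range_of_cat.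
  rewrite ew -cat_rcons in Lr pr.
  apply: (lev_beginning filF) Lr => //; first exact: baseset_rng.
  by have := is_path_src pr; rewrite -cats1 range_of_cat.
Qed.

Lemma near_lev (eta : filters G) w A :
  \forall F \near eta, lev (filter_set F) w A <-> lev (filter_set eta) w A.
Proof.
case: (pselect (valid w A)) => [vA|nv]; last first.
  by apply: (@filterS _ (nbhs eta) (nbhs_filter eta) setT) => [F _|];
    [split=> /lev_valid|exact: filterT].
have [p [<- <-]] := valid_idem vA.
apply: (@filterS _ (nbhs eta) (nbhs_filter eta) _ _ _ (near_filter eta (Some p))).
by move=> F; rewrite !levE.
Qed.

Lemma near_level xi w A :
  \forall eta \near xi, level eta w A <-> level xi w A.
Proof. exact: (@initial_continuous _ (filters G) set_val xi _ (near_lev _ w A)). Qed.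

Lemma elts_filter xi : is_filter (elts xi).
Proof. exact: (set_valP (set_val xi)). Qed.

(** Tight filters inherit those properties of ultrafilters that involve finitely many
    elements. *)
Lemma tight_approx xi (P : set (filters G)) : nbhs (set_val xi : filters G) P ->
  exists2 F, is_ultrafilter (filter_set F) & P F.
Proof. by move=> /(set_valP xi)[F [uF PF]]; exists F. Qed.

Lemma tight_prime xi w A B : baseset A -> baseset B ->
  level xi w (A `|` B) -> level xi w A \/ level xi w B.
Proof.
move=> bA bB LAB.
have [F uF [eAB [eA eB]]] :=
  tight_approx (filterI (near_lev (set_val xi) w (A `|` B))
    (filterI (near_lev (set_val xi) w A) (near_lev (set_val xi) w B))).
have /(ultra_prime uF bA bB)[LA|LB] : lev (filter_set F) w (A `|` B) by apply/eAB.
- by left; apply/eA.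
- by right; apply/eB.
Qed.

Lemma tight_prime_bigcup (I : choiceType) (D : set I) (A : I -> set V) xi w :
  finite_set D -> (forall i, D i -> baseset (A i)) ->
  level xi w (\bigcup_(i in D) A i) -> exists2 i, D i & level xi w (A i).
Proof.
move=> /finite_seqP[s ->]; elim: s => [|i s IHs] bA.
  by move=> /lev_valid[_ [x []]].
rewrite (_ : \bigcup_(j in _) A j = A i `|` \bigcup_(j in [set` s]) A j); last first.
  by rewrite !bigcup_seq big_cons.
have bs j : j \in s -> baseset (A j) by move=> js; apply: bA; rewrite /= inE js orbT.
have bU : baseset (\bigcup_(j in [set` s]) A j).
  rewrite bigcup_seq; elim: (s) bs => [|j t IHt] bs; rewrite ?big_nil ?big_cons.
    exact: baseset0.
  apply: basesetU; first by apply: bs; rewrite mem_head.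
  by apply: IHt => k kt; apply: bs; rewrite inE kt orbT.
move=> /(tight_prime (bA i (mem_head _ _)) bU)[Li|].
  by exists i => //=; rewrite mem_head.
by move=> /(IHs bs)[j js Lj]; exists j => //=; rewrite inE [_ \in s]js orbT.
Qed.

Lemma tight_finite xi w A : finite_set A -> level xi w A ->
  exists2 v, A v & level xi w [set v].
Proof.
move=> fA; rewrite -{1}[A]image_id -bigcup_imset1 => /tight_prime_bigcup.
by apply=> // v _; exact: baseset1.
Qed.

(** Regularity makes the choice of the edge a choice among finitely many, which is kept
    by the limits of ultrafilters. *)
Lemma tight_emit xi w v : is_regular v -> level xi w [set v] ->
  exists2 e, src e = v & level xi (rcons w e) (rng e).
Proof.
move=> [[e0 /= e0v] fe] Lv.
have near_all : nbhs (set_val xi : filters G)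
    [set F | forall e, emits [set v] e ->
       (lev (filter_set F) (rcons w e) (rng e) <-> level xi (rcons w e) (rng e))].
  by apply: near_finite => // e _; exact: near_lev.
have [F uF [eLv eL]] :=
  tight_approx (filterI (near_lev (set_val xi) w [set v]) near_all).
have /(ultra_emit uF)[f fe0 Lf] : lev (filter_set F) w [set src e0].
  by rewrite e0v; apply/eLv.
have fv : src f = v := etrans fe0 e0v.
by exists f => //; apply/eL.
Qed.

Hypothesis hG : RFUM2 G.

(** Every set of the generated Boolean ring is covered by finitely many vertices and
    infinite terminal sets, and a prime filter has to choose one of them. *)
Lemma tight_terminal xi w A : level xi w A ->
  (exists v, level xi w [set v]) \/
  exists C, [/\ terminal C, infinite_set C & level xi w C].
Proof.
move=> LA; have [_ _ bA _] := lev_valid LA.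
have {LA} : exists2 B, level xi w B & B `<=` A by exists A.
have sub1 B v : level xi w B -> B `<=` [set v] -> exists v, level xi w [set v].
  move=> LB Bv; have fB : finite_set B by apply: sub_finite_set (finite_set1 v).
  by have [u _ Lu] := tight_finite fB LB; exists u.
have term B C : terminal C -> level xi w B -> B `<=` C ->
    (exists v, level xi w [set v]) \/
    exists C, [/\ terminal C, infinite_set C & level xi w C].
  move=> tC LB BC; have [pw _ _ Bw] := lev_valid LB.
  case: (pselect (finite_set B)) => [fB|iB].
    by left; have [u _ Lu] := tight_finite fB LB; exists u.
  have iC : infinite_set C by apply: sub_infinite_set iB.
  right; exists C; split=> //.
  apply: (lev_up (elts_filter xi)) LB => //; first exact: terminal_baseset.
  have [->//|[f ew]] : range_of w = setT \/ exists f, range_of w = rng f.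
    by case: (w) => [|f u]; [left|right; exists (last f u)].
  rewrite ew in Bw *; case: (terminal_genvertP tC iC (genvert_rng f)) => // fI.
  by case: iB; apply: sub_finite_set fI => x Bx; split; [apply: BC|apply: Bw].
elim/baseset_ind: A / bA => [A|A B bA bB hA hB]; last first.
  split=> -[D LD sD].
  - by apply: hA; exists D => // x /sD[].
  - have [_ _ bD _] := lev_valid LD.
    have : level xi w ((D `&` A) `|` (D `&` B)) by rewrite -setIUr setIidl.
    move=> /tight_prime[||LA|LB]; try by [exact: (basesetI bD bA)|exact: (basesetI bD bB)].
      by apply: hA; exists (D `&` A).
    by apply: hB; exists (D `&` B).
  - by apply: hA; exists D => // x /sD[].
elim/genvert_ind: A / => [|v|e|A B gA gB hA hB].
- by move=> [B /lev_valid[_ [x Bx] _ _] /(_ x Bx)].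
- by move=> [B LB Bv]; left; apply: sub1 LB Bv.
- move=> [B LB Be]; have [k [A [eA tA]]] := hG e.
  have [_ _ bB _] := lev_valid LB.
  have bA i : baseset (A i).
    apply: baseset_genvert; case: (tA i) => [[]//|[]//|[v _ ->]]; exact: genvert1.
  have : level xi w (\bigcup_(i in [set: 'I_k]) (B `&` A i)).
    by rewrite -setI_bigcupr -eA setIidl.
  move=> /tight_prime_bigcup[||i _ LBi]; first exact: finite_finset.
    by move=> i _; exact: (basesetI bB (bA _)).
  case: (tA i) => [m|m|[v _ ev]].
  + by apply: (term _ (A i) _ LBi (@subIsetr _ _ _)); constructor 1.
  + by apply: (term _ (A i) _ LBi (@subIsetr _ _ _)); constructor 3.
  + by left; apply: (sub1 (B `&` A i) v); rewrite // ev.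
- split=> -[D LD sD].
    have [_ _ bD _] := lev_valid LD.
    have : level xi w ((D `&` A) `|` (D `&` B)) by rewrite -setIUr setIidl.
    move=> /tight_prime[||LA|LB]; try by [exact: (basesetI bD (baseset_genvert gA))|
      exact: (basesetI bD (baseset_genvert gB))].
      by apply: hA; exists (D `&` A).
    by apply: hB; exists (D `&` B).
  by apply: hA; exists D => // x /sD[].
Qed.

End Tight.

(** * The tight filter of a boundary path *)

Section Boundary.
Variable G : ultragraph.
Local Notation V := (vertex G).
Local Notation E := (edge G).
Local Notation ES := (ES G).
Implicit Types (A B C : set V) (v : V) (e f : E) (w u : seq E) (F : set ES).
Implicit Types (y z : bpath G) (xi : tight_spectrum G).

(** Arguments that use [begins] only, with [begins_case] to look at what follows a
    beginning, need not distinguish finite from infinite paths. *)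
Definition begins y u : Prop :=
  match y with
  | BInf p _ => mkseq p (size u) = u
  | BFin x _ => prefix u x.1
  end.

Lemma mkseq_rcons (p : nat -> E) w e :
  mkseq p (size (rcons w e)) = rcons w e <-> mkseq p (size w) = w /\ p (size w) = e.
Proof.
rewrite size_rcons mkseqS; split=> [/eqP|[-> ->]//].
by rewrite eqseq_rcons => /andP[/eqP -> /eqP ->].
Qed.

Lemma extendsE w (P : set E) y :
  extends w P y <-> exists2 e, P e & begins y (rcons w e).
Proof.
case: y => [p ip|[u C] h] /=; split.
- by move=> [ew Pe]; exists (p (size w)) => //; apply/mkseq_rcons.
- by move=> [e Pe /mkseq_rcons[ew pe]]; rewrite ew pe.
- by move=> [e [t [-> Pe]]]; exists e => //; rewrite -cat_rcons prefix_prefix.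
- by move=> [e Pe /prefixP[t ->]]; exists e, t; rewrite cat_rcons.
Qed.

Lemma finptP w C y : finpt (w, C) y ->
  [/\ terminal C, @is_path G w, C `<=` range_of w & forall u, begins y u <-> prefix u w].
Proof.
by case: y => //= x h e; subst x; move/in_XfinE: (h) => [[? ? ?] ?]; split.
Qed.

Lemma finpt_inj w C w' C' y : finpt (w, C) y -> finpt (w', C') y -> w = w' /\ C = C'.
Proof. by case: y => //= x h -> [-> ->]. Qed.

Lemma begins_catl y w u : begins y (w ++ u) -> begins y w.
Proof.
case: y => [p ip|x h] /=; last exact: catl_prefix.
rewrite size_cat /mkseq iotaD map_cat => /eqP; rewrite eqseq_cat ?size_map ?size_iota//.
by move=> /andP[/eqP].
Qed.

Lemma begins_rcons y w e u : begins y (w ++ e :: u) -> begins y (rcons w e).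
Proof. by rewrite -cat_rcons; exact: begins_catl. Qed.

Lemma begins_size y w u : begins y w -> begins y u -> size w = size u -> w = u.
Proof.
case: y => [p ip|x h] /=; first by move=> <- <-; rewrite !size_mkseq => ->.
by rewrite !prefixE => /eqP ew /eqP eu es; rewrite -ew -eu es.
Qed.

Lemma begins_take y w n : begins y w -> begins y (take n w).
Proof. by rewrite -{1}[w](cat_take_drop n); exact: begins_catl. Qed.

Lemma begins_total y w u : begins y w -> begins y u -> (size w <= size u)%N ->
  prefix w u.
Proof.
move=> yw yu le; rewrite prefixE; apply/eqP; apply: (@begins_size y) => //.
  exact: begins_take.
exact: size_takel.
Qed.

Lemma begins_next_inj y w e f : begins y (rcons w e) -> begins y (rcons w f) -> e = f.
Proof.
move=> be bf; have := begins_size be bf; rewrite !size_rcons => /(_ erefl)/eqP.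
by rewrite eqseq_rcons => /andP[_ /eqP].
Qed.

Lemma begins_case y w : begins y w ->
  (exists e, begins y (rcons w e)) \/ exists C, finpt (w, C) y.
Proof.
case: y => [p ip|[u C] h] /=.
  by move=> ew; left; exists (p (size w)); apply/mkseq_rcons.
move=> /prefixP[[|e t] ->]; first by right; exists C; rewrite cats0.
by left; exists e; rewrite -cat_rcons prefix_prefix.
Qed.

Lemma begins_path y w : begins y w -> is_path w.
Proof.
case: y => [p ip|[u C] h] /=; last first.
  by move=> /prefixP[t eu]; move/in_XfinE: (h) => [[]] /=; rewrite eu => /is_path_catl.
move: w; elim/last_ind => [//|w e IHw].
move=> /mkseq_rcons[ew pe]; have pw := IHw ew; apply: is_path_rcons => //.
move: ew pe; case/lastP: (w) => [//|w' f] /mkseq_rcons[ew' pf].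
rewrite -cats1 range_of_cat /= => <-; rewrite size_cat addn1 -pf; exact: ip.
Qed.

Lemma begins_nil y : begins y [::].
Proof. by case: y => [p ip|x h] /=; last exact: prefix0s. Qed.

(** For [A] in the generated family this is the basic open set [Dcyl w A]; other sets [A]
    of the Boolean ring occur in the filters as well. *)
Definition cyl w A : set (bpath G) :=
  [set y | extends w (emits A) y \/ exists2 C, finpt (w, C) y & carries C A].

Lemma cyl_begins w A y : cyl w A y -> begins y w.
Proof.
case=> [/extendsE[e _]|[C /finptP[_ _ _ ->] _]]; last exact: prefix_refl.
by rewrite -cats1; exact: begins_catl.
Qed.

Lemma next_end y w e C : begins y (rcons w e) -> finpt (w, C) y -> False.
Proof.
move=> ye /finptP[_ _ _] h; move/h: ye => /size_prefix.
by rewrite size_rcons ltnn.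
Qed.

Lemma cyl_next w e A y : begins y (rcons w e) -> (cyl w A y <-> A (src e)).
Proof.
move=> ye; split=> [[/extendsE[f Af yf]|[C yC _]]|Ae].
- by rewrite (begins_next_inj ye yf).
- by case: (next_end ye yC).
- by left; apply/extendsE; exists e.
Qed.

Lemma cyl_end w C A y : finpt (w, C) y -> (cyl w A y <-> carries C A).
Proof.
move=> yC; split=> [[/extendsE[f _ yf]|[C' yC' cA]]|cA].
- by case: (next_end yf yC).
- by have [_ ->] := finpt_inj yC yC'.
- by right; exists C.
Qed.

Definition boundary_filter y : set ES :=
  [set x | if x is Some p then cyl (iword p) (iset p) y else False].

Lemma lev_boundary_filter y w A : lev (boundary_filter y) w A <-> valid w A /\ cyl w A y.
Proof.
split=> [LA|[/valid_idem[p [<- <-]] c]]; last by exists p.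
by split; [exact: lev_valid LA|case: LA => p c [<- <-]].
Qed.

Lemma lev_next y w e : begins y (rcons w e) -> lev (boundary_filter y) w [set src e].
Proof.
move=> ye; apply/lev_boundary_filter; split; last by apply/(cyl_next _ ye).
have := begins_path ye; rewrite -cats1 => pe.
split=> [||| _ ->].
- exact: is_path_catl pe.
- by exists (src e).
- exact: baseset1.
- exact: is_path_src pe.
Qed.

Lemma lev_end y w C A : finpt (w, C) y -> baseset A -> carries C A ->
  lev (boundary_filter y) w (C `&` A).
Proof.
move=> yC bA cA; have [tC pw Cw _] := finptP yC.
apply/lev_boundary_filter; split; last first.
  by apply/(cyl_end _ yC); apply: carriesI => //; left.
split=> //; first exact: carries_meet.
  by apply: basesetI => //; exact: terminal_baseset.
by move=> x [/Cw].
Qed.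

Lemma begins_lev y w : begins y w <-> exists A, lev (boundary_filter y) w A.
Proof.
split=> [yw|[A /lev_boundary_filter[_ /cyl_begins//]]].
case: (begins_case yw) => [[e ye]|[C yC]].
  by exists [set src e]; exact: lev_next.
have [tC _ _ _] := finptP yC.
exists (C `&` C); apply: lev_end => //; [exact: terminal_baseset|by left].
Qed.

Lemma boundary_filterP y : is_filter (boundary_filter y).
Proof.
split.
- by have [A [p yp _]] := (begins_lev y [::]).1 (begins_nil y); exists (Some p).
- by [].
- move=> [p|//] [q|]; last by move=> _ /ESle_None.
  rewrite /boundary_filter /= => yp /ESleP pq.
  case: pq => [[ew pq]|[e [u [ew qe]]]]; rewrite ew in yp.
    case: yp => [/extendsE[e pe ye]|[C yC cp]].
      by left; apply/extendsE; exists e => //; exact: pq.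
    by right; exists C => //; exact: carriesS cp.
  by apply/cyl_next; [exact: begins_rcons (cyl_begins yp)|].
- have below (p q : idem G) : cyl (iword p) (iset p) y -> cyl (iword q) (iset q) y ->
      (size (iword p) <= size (iword q))%N -> exists m, [/\ boundary_filter y m,
        ESle m (Some p) & ESle m (Some q)].
    move=> yp yq /(begins_total (cyl_begins yp) (cyl_begins yq))/prefixP[[|e t] ew].
      rewrite cats0 in ew; rewrite ew in yq.
      suff [D [m ym [mw mD]] [Dp Dq]] : exists2 D, lev (boundary_filter y) (iword p) D &
          D `<=` iset p /\ D `<=` iset q.
        by exists (Some m); split=> //; apply/ESleP; left; rewrite mw mD ?ew.
      case: (begins_case (cyl_begins yp)) => [[e ye]|[C yC]].
        exists [set src e]; first exact: lev_next.
        by split=> _ ->; apply/cyl_next; eassumption.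
      exists (C `&` (iset p `&` iset q)); last by split=> x [_ []].
      apply: lev_end => //; first exact: basesetI (iset_base p) (iset_base q).
      by apply: carriesI; apply/cyl_end; eassumption.
    have ye : begins y (rcons (iword p) e).
      by apply: (@begins_rcons _ _ _ t); rewrite -ew; exact: cyl_begins yq.
    exists (Some q); split=> //; last exact: ESle_refl.
    apply/ESleP; right; exists e, t; split=> //.
    by apply/cyl_next; eassumption.
  move=> [p|//] [q|//] yp yq.
  case/orP: (leq_total (size (iword p)) (size (iword q))) => le.
    exact: below.
  by have [m [ym mq mp]] := below _ _ yq yp le; exists m.
Qed.

(** A larger filter has no words besides the beginnings of [y]: an edge [e] continuing the
    whole of a finite path [w] would have its source in every set over [w], also in
    [C] without that source when [C] is infinite, while a sink emits no edge. *)
Lemma boundary_ultrafilter y :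
  (forall w C, finpt (w, C) y -> infinite_set C \/ exists2 v, is_sink v & C = [set v]) ->
  is_ultrafilter (boundary_filter y).
Proof.
move=> yend; split; first exact: boundary_filterP.
move=> F filF yF; have [_ n0 _ _] := filF.
have levF w A : lev (boundary_filter y) w A -> lev F w A.
  by move=> [p yp e]; exists p => //; exact: yF.
apply: lev_ext => // w A vA; split=> [LA|]; last exact: levF.
apply/lev_boundary_filter; split=> //.
have yw : begins y w.
  case: (pselect (exists u C, finpt (u, C) y)) => [[u [C yC]]|noend].
    have [tC pu Cu hu] := finptP yC; apply/hu.
    have LC : lev F u C.
      rewrite -[C]setIid; apply/levF/lev_end => //; last by left.
      exact: terminal_baseset.
    case: (lev_compat filF LC LA) => [->|[e [t [ew Ce]]]|[e [t [-> _]]]].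
    - exact: prefix_refl.
    - exfalso; case: (yend _ _ yC) => [iC|[v sv eC]]; last first.
        rewrite eC /= in Ce; suff : emits [set v] e by rewrite sv.
        exact: Ce.
      have LCe : lev F u (C `&` ~` [set src e]).
        rewrite -[C in C `&` _]setIid -setIA -setDE.
        apply/levF/lev_end => //.
          by apply: basesetD; [exact: terminal_baseset|exact: baseset1].
        right; split=> //; rewrite setDD; apply: sub_finite_set (finite_set1 (src e)).
        by move=> x [].
      case: (lev_compat filF LCe LA) => [eu|[f [s [ew' [_ ne]]]]|[f [s [ew' _]]]].
      + move/(congr1 size): ew; rewrite -eu size_cat /= => /eqP.
        by rewrite -{1}[size u]addn0 eqn_add2l.
      + move: ew'; rewrite ew => /eqP; rewrite eqseq_cat// eqxx /= => /eqP[ef _].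
        by apply: ne; rewrite ef.
      + move/(congr1 size): ew; rewrite ew' !size_cat /= => /eqP.
        by rewrite -addnA -{1}[size w]addn0 eqn_add2l.
    - exact: prefix_prefix.
  have [e [u [ye su]]] : exists e u, begins y (rcons u e) /\ size u = size w.
    elim: (size w) => [|n [e [u [yu su]]]].
      case: (begins_case (begins_nil y)) => [[e ye]|[C yC]]; first by exists e, [::].
      by case: noend; exists [::], C.
    case: (begins_case yu) => [[f yf]|[C yC]].
      by exists f, (rcons u e); rewrite size_rcons su.
    by case: noend; exists (rcons u e), C.
  have yu : begins y u by move: ye; rewrite -cats1; exact: begins_catl.
  case: (lev_compat filF (levF _ _ (lev_next ye)) LA) => [<-//|[f [t [ew _]]]|[f [t [eu _]]]].
    by move/(congr1 size): ew; rewrite size_cat su -{1}[size w]addn0 => /eqP; rewrite eqn_add2l.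
  by move/(congr1 size): eu; rewrite size_cat su -{1}[size w]addn0 => /eqP; rewrite eqn_add2l.
case: (begins_case yw) => [[e ye]|[C yC]].
  have /(lev_setI filF LA) := levF _ _ (lev_next ye).
  by move=> /lev_valid[_ [x [Ax xe]] _ _]; apply/(cyl_next _ ye); rewrite -xe.
apply/(cyl_end _ yC); have [tC _ _ _] := finptP yC.
have [_ _ bA _] := lev_valid LA.
have [//|cN] := carries_baseset tC bA.
have : lev F w (C `&` (C `\` A)).
  apply/levF/lev_end => //; first by apply: basesetD => //; exact: terminal_baseset.
  by rewrite setDE; apply: carriesI => //; left.
by move=> /(lev_setI filF LA)/lev_valid[_ [x [Ax [_ [_ nx]]]]].
Qed.

(** The neighborhoods of a filter are given by finitely many elements. *)
Lemma nbhs_filters (xi : filters G) (O : set (filters G)) : nbhs xi O ->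
  exists2 X : set ES, finite_set X &
    forall F : filters G, (forall x, X x -> (filter_set F x <-> filter_set xi x)) -> O F.
Proof.
pose FF := filter_from (@finite_set ES)
  (fun X => [set F : filters G | forall x, X x -> (filter_set F x <-> filter_set xi x)]).
have FFF : Filter FF.
  apply: filter_from_filter; first by exists set0.
  move=> X Y fX fY; exists (X `|` Y); first by rewrite finite_setU.
  by move=> F h; split=> x hx; apply: h; [left|right].
have : FF --> xi.
  apply: cvg_filters => x; exists [set x] => // F /(_ x); exact.
by move=> /[apply] -[X fX h]; exists X => // F hF; apply: h.
Qed.

Lemma principal_is_filter (c : idem G) : is_filter [set x | ESle (Some c) x].
Proof.
split.
- by exists (Some c); exact: ESle_refl.
- by move/ESle_None.
- by move=> x y cx xy; exact: ESle_trans xy.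
- by move=> x y cx cy; exists (Some c); split=> //; exact: ESle_refl.
Qed.

(** A neighborhood involves finitely many elements, hence finitely many edges.  An
    ultrafilter continuing [w] by an edge that starts at [v] and is not one of
    these lies in the neighborhood. *)
Lemma emitter_tight w v y : finpt (w, [set v]) y -> infinite_set (emits [set v]) ->
  forall eta : filters G, filter_set eta = boundary_filter y -> tight eta.
Proof.
move=> yv infv eta eeta O /nbhs_filters[X fX hX].
have [tC pw vw hy] := finptP yv.
pose letters (x : ES) : set E := if x is Some p then [set` iword p] else set0.
(* The letters of the elements of [X] are the edges to avoid. *)
have : infinite_set (emits [set v] `\` \bigcup_(x in X) letters x).
  apply: infinite_setD => //; apply: bigcup_finite => // -[p|] _ //=; exact: finite_seq.
move=> /infinite_setN0[e [/= ev ne]].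
have [c [cw cA]] : exists p : idem G, iword p = rcons w e /\ iset p = rng e.
  apply: valid_idem; split.
  - by apply: is_path_rcons => //; apply: vw.
  - exact: rng_neq0.
  - exact: baseset_rng.
  - by rewrite -cats1 range_of_cat.
have [F uF cF] := ultrafilter_ext (principal_is_filter c).
have [filF _] := uF; have [_ n0 _ _] := filF.
pose zeta : filters G := SigSub (mem_set filF : F \in [set F | is_filter F]).
have ezeta : filter_set zeta = F by [].
exists zeta; split; first by rewrite /= ezeta.
have Fc : lev F (rcons w e) (rng e).
  by exists c => //; apply: cF; exact: ESle_refl.
apply: hX => -[p|] Xp; rewrite ezeta eeta; last by split=> // /n0.
have ep : e \notin iword p by apply/negP => ep; apply: ne; exists (Some p).
have bp := iset_base p; have pp : iset p `<=` range_of (iword p) := @iset_sub _ p.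
split=> [/levE Fp|yp].
  rewrite /boundary_filter /=.
  case: (lev_compat filF Fc Fp) => [ew|[f [t [ew _]]]|[f [t [ew pf]]]].
  - by move: ep; rewrite -ew mem_rcons mem_head.
  - by move: ep; rewrite ew mem_cat mem_rcons mem_head.
  - case/lastP: t => [|t a] in ew.
      move: ew; rewrite cats1 => /eqP; rewrite eqseq_rcons => /andP[/eqP <- /eqP ef].
      by apply/(cyl_end _ yv)/carries1; rewrite -ev ef.
    move: ew; rewrite -rcons_cons -rcons_cat => /eqP; rewrite eqseq_rcons => /andP[/eqP ew _].
    apply/(@cyl_next _ f) => //; apply: (@begins_rcons _ _ _ t); rewrite -ew.
    exact/hy/prefix_refl.
apply/levE; rewrite /boundary_filter /= in yp.
have /hy/prefixP[[|f t] ew] := cyl_begins yp.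
  rewrite cats0 in ew; rewrite -ew in yp *.
  apply: (lev_beginning filF (e := e) (u := [::])) => //; first by rewrite ew.
    by rewrite ev; apply/carries1/(cyl_end _ yv).
  by rewrite cats1; exact: Fc.
apply: (lev_beginning filF (e := f) (u := rcons t e)) => //.
  apply/cyl_next; last exact: yp.
  by apply: (@begins_rcons _ _ _ t); rewrite -ew; exact/hy/prefix_refl.
by rewrite -rcons_cons -rcons_cat -ew; exact: Fc.
Qed.

Lemma boundary_filter_tight y (eta : filters G) : filter_set eta = boundary_filter y -> tight eta.
Proof.
move=> eeta.
case: (pselect (exists w v, finpt (w, [set v]) y /\ infinite_set (emits [set v])))
  => [[w [v [yv iv]]]|no].
  exact: (emitter_tight yv iv eeta).
apply: subset_closure; rewrite /= eeta; apply: boundary_ultrafilter => w C yC.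
have [tC _ _ _] := finptP yC.
case: (pselect (finite_set C)) => [fC|]; [right|by left].
have [v ev] := terminal_finite tC fC; exists v => //.
apply/eqP; apply: contra_notT no => /set0P ne; exists w, v.
rewrite -ev; split=> //; rewrite ev => fe.
have /terminal1 nreg : terminal [set v] by rewrite -ev.
by apply: nreg; split.
Qed.

Definition tight_of y : tight_spectrum G :=
  let eta : filters G := SigSub (mem_set (boundary_filterP y)) in
  SigSub (mem_set (@boundary_filter_tight y eta erefl)).

Lemma elts_tight_of y : elts (tight_of y) = boundary_filter y.
Proof. by []. Qed.

Lemma tight_eq xi xi' : elts xi = elts xi' -> xi = xi'.
Proof. by move=> e; apply: val_inj; apply: val_inj. Qed.

Lemma bpath_fin_eq (x x' : seq E * set V) (h : in_Xfin x) (h' : in_Xfin x') :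
  x = x' -> BFin h = BFin h'.
Proof. by move=> e; subst x'; congr BFin; exact: Prop_irrelevance. Qed.

Lemma bpath_inf_eq (p p' : nat -> E) (h : is_inf_path p) (h' : is_inf_path p') :
  p = p' -> BInf h = BInf h'.
Proof. by move=> e; subst p'; congr BInf; exact: Prop_irrelevance. Qed.

Lemma beginnings_inj : injective (@beginnings G).
Proof.
have inb (p : nat -> E) n : beginnings (InfWord p) (mkseq p n).
  by rewrite /beginnings /mkset size_mkseq.
have inf_fin (p : nat -> E) w : beginnings (InfWord p) <> beginnings (FinWord w).
  move=> e; have := inb p (size w).+1.
  by rewrite e => /size_prefix; rewrite size_mkseq ltnn.
move=> [w|p] [w'|p'] e.
- have : beginnings (FinWord w') w by rewrite -e /= prefix_refl.
  have : beginnings (FinWord w) w' by rewrite e /= prefix_refl.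
  move=> /= /prefixP[t ->] /size_prefix; rewrite size_cat -{2}[size w']addn0.
  by rewrite leq_add2l leqn0 => /nilP ->; rewrite cats0.
- by case: (inf_fin p' w); rewrite e.
- by case: (inf_fin p w').
- congr InfWord; apply/funext => n.
  have := inb p n.+1; rewrite e /beginnings /mkset size_mkseq.
  by rewrite !mkseqS => /eqP; rewrite eqseq_rcons => /andP[_ /eqP].
Qed.

Definition word_of y : word G :=
  match y with BInf p _ => InfWord p | BFin x _ => FinWord x.1 end.

Lemma beginnings_word_of y : beginnings (word_of y) = [set u | begins y u].
Proof. by case: y => [p ip|x h]; apply/seteqP; split=> u /=. Qed.

Lemma has_word_tight_of y a : has_word (tight_of y) a <-> word_of y = a.
Proof.
have e : [set u | exists2 p, elts (tight_of y) (Some p) & iword p = u] = beginnings (word_of y).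
  rewrite beginnings_word_of; apply/seteqP; split=> u /=.
    by move=> [p yp <-]; exact: cyl_begins yp.
  by move=> /begins_lev[A [p yp [pu _]]]; exists p.
split=> [[_]|<-]; first by rewrite e => /beginnings_inj.
split=> //; case: (y) => [//|[w C] h] /=.
by have [[]] := (in_XfinE _).1 h.
Qed.

Lemma level_finpt_self w C y : finpt (w, C) y -> level (tight_of y) w C.
Proof.
move=> yC; have [tC _ _ _] := finptP yC; rewrite -[C]setIid.
by apply: lev_end => //; [exact: terminal_baseset|left].
Qed.

Lemma bpath_word_level y y' : word_of y = word_of y' ->
  (forall w, word_of y = FinWord w -> level (tight_of y) w = level (tight_of y') w) -> y = y'.
Proof.
case: y y' => [p ip|[w C] h] [p' ip'|[w' C'] h'] //= [e] hl.
  exact: bpath_inf_eq.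
subst w'; apply: bpath_fin_eq; congr pair.
have el := hl w erefl.
have yC : finpt (w, C) (BFin h) by [].
have yC' : finpt (w, C') (BFin h') by [].
have [tC _ _ _] := finptP yC; have [tC' _ _ _] := finptP yC'.
apply: carries_inj => //.
  have := level_finpt_self yC'; rewrite -el => /lev_boundary_filter[_].
  by move/(cyl_end _ yC).
have := level_finpt_self yC; rewrite el => /lev_boundary_filter[_].
by move/(cyl_end _ yC').
Qed.

Lemma tight_of_inj : injective tight_of.
Proof.
move=> y y' e; apply: bpath_word_level; last by move=> w _; rewrite e.
by apply/has_word_tight_of; rewrite e; apply/has_word_tight_of.
Qed.

(** * Every tight filter comes from a boundary path *)

(** A filter is known from its words and, when there is a longest one, from what it
    carries over that word. *)
Lemma tight_of_eq xi y :
  (forall w, begins y w <-> exists A, level xi w A) ->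
  (forall w C A, finpt (w, C) y -> valid w A -> (level xi w A <-> carries C A)) ->
  xi = tight_of y.
Proof.
move=> hw hend; apply: tight_eq; have filx := elts_filter xi.
rewrite elts_tight_of; apply: lev_ext => //; first by case: filx.
move=> w A vA; split=> [LA|/lev_boundary_filter[_ yA]].
  apply/lev_boundary_filter; split=> //; have yw : begins y w by apply/hw; exists A.
  case: (begins_case yw) => [[e ye]|[C yC]]; last by apply/(cyl_end _ yC)/(hend _ _ _ yC vA).
  apply/(cyl_next _ ye); have [B] := (hw _).1 ye; rewrite -cats1.
  by move=> /(lev_vertex filx)/(lev_setI filx LA)/lev_valid[_ [x [Ax <-]]].
case: (begins_case (cyl_begins yA)) => [[e ye]|[C yC]]; last first.
  by apply/(hend _ _ _ yC vA)/(cyl_end _ yC).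
have [B LB] := (hw _).1 ye; rewrite -cats1 in LB.
have [_ _ bA Aw] := vA; apply: (lev_beginning filx) LB => //.
exact/(cyl_next _ ye).
Qed.

Hypothesis hG : RFUM2 G.

(** A filter whose words are arbitrarily long has one word of each length, and
    these words are the beginnings of an infinite path. *)
Lemma level_inf xi : (forall n, exists2 w, size w = n & exists A, level xi w A) ->
  exists y, xi = tight_of y.
Proof.
move=> unb; have filx := elts_filter xi.
have chain w w' A A' : level xi w A -> level xi w' A' -> size w = size w' -> w = w'.
  move=> LA LA' es; case: (lev_compat filx LA LA') => [//|[e [u [ew _]]]|[e [u [ew _]]]].
    by move/eqP: es; rewrite ew size_cat -{1}[size w]addn0 eqn_add2l.
  by move/eqP: es; rewrite ew size_cat -{2}[size w']addn0 eqn_add2l.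
have /choice[p hp] : forall n, exists e, exists2 w, size w = n & exists A, level xi (rcons w e) A.
  move=> n; have [w sw [A LA]] := unb n.+1.
  by case/lastP: w sw LA => [//|w e]; rewrite size_rcons => -[sw] LA; exists e, w => //; exists A.
have wp n : exists A, level xi (mkseq p n) A.
  elim: n => [|n [A LA]].
    by have [[|//] _ [A LA]] := unb 0; exists A.
  have [w sw [B LB]] := hp n; exists B; rewrite mkseqS.
  suff -> : mkseq p n = w by [].
  rewrite -cats1 in LB.
  by apply: chain LA (lev_vertex filx LB) _; rewrite size_mkseq.
have ip : is_inf_path p.
  move=> i; have [A LA] := wp i.+2.
  have [pw _ _ _] := lev_valid LA; rewrite mkseqS -cats1 in pw.
  by have := is_path_src pw; rewrite mkseqS -cats1 range_of_cat.
exists (BInf ip); apply: tight_of_eq => // w; split=> /= [<-|[A LA]]; first exact: wp.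
by have [B LB] := wp (size w); apply: chain LB LA _; rewrite size_mkseq.
Qed.

(** Over the longest word, if there is one, the filter either is principal at a vertex,
    which [tight_emit] forbids to be regular, or contains no finite set and an infinite
    terminal set, whose filter it must be. *)
Lemma tight_of_surj xi : exists y, xi = tight_of y.
Proof.
have filx := elts_filter xi.
pose P n := exists2 w, size w = n & exists A, level xi w A.
have P0 : P 0.
  have [[[p|] xp] n0 _ _] := filx; last by [].
  have /levE := xp; case: (iword p) => [|e w] L.
    by exists [::] => //; exists (iset p).
  by exists [::] => //; exists [set src e]; exact: (lev_vertex filx (w := [::]) L).
case: (pselect (forall n, P n)) => [|/existsNP]; first exact: level_inf.
move=> unb.
have [n [w sw [A LA]] nS] : exists2 n, P n & ~ P n.+1.
  apply: contrapT => no; case: unb => n; apply; elim: n => [//|n Pn].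
  by apply: contrapT => PSn; apply: no; exists n.
have maxw u e t : u = w ++ e :: t -> ~ exists B, level xi u B.
  move=> -> [B LB]; apply: nS; exists (rcons w e); first by rewrite size_rcons sw.
  case: t LB => [|f t] LB; first by exists B; rewrite -cats1.
  by exists [set src f]; apply: (lev_vertex filx (u := t)); rewrite cat_rcons; exact: LB.
have [pw _ _ _] := lev_valid LA.
have words u : prefix u w <-> exists B, level xi u B.
  split=> [/prefixP[[|e t] ew]|[B LB]].
  - by exists A; rewrite cats0 in ew; rewrite -ew.
  - by exists [set src e]; apply: (lev_vertex filx (u := t)); rewrite -ew; exact: LA.
  - case: (lev_compat filx LA LB) => [->|[e [t [eu _]]]|[e [t [-> _]]]].
    + exact: prefix_refl.
    + by case: (maxw _ _ _ eu); exists B.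
    + exact: prefix_prefix.
have build C : terminal C -> C `<=` range_of w ->
    (forall B, valid w B -> (level xi w B <-> carries C B)) -> exists y, xi = tight_of y.
  move=> tC Cw hC.
  have xfin : in_Xfin (w, C) by apply/in_XfinE; split=> //; split=> //; exact: terminal_genvert.
  exists (BFin xfin); apply: tight_of_eq => // u C' B [eu eC]; subst u C'; exact: hC.
case: (pselect (exists v, level xi w [set v])) => [[v Lv]|nov].
  have [_ _ _ vw] := lev_valid Lv.
  apply: (build [set v]) => //.
    apply/terminal1 => reg; have [e _ Le] := tight_emit reg Lv.
    by apply: (maxw (rcons w e) e [::]); [rewrite cats1|exists (rng e)].
  move=> B [_ _ bB Bw]; rewrite carries1; split=> [LB|Bv].
    by have /lev_valid[_ [x [Bx <-]]] := lev_setI filx LB Lv.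
  by apply: (lev_up filx) Lv => // _ ->.
have nofin B : level xi w B -> infinite_set B.
  by move=> LB fB; have [v _ Lv] := tight_finite fB LB; apply: nov; exists v.
have [//|[C [tC iC LC]]] := tight_terminal hG LA.
have [_ _ bC Cw] := lev_valid LC.
apply: (build C) => // B [_ _ bB Bw]; split=> [LB|cB].
  have [//|cN] := carries_baseset tC bB.
  case: (nofin _ (lev_setI filx LC LB)).
  case: cN => [CN|[_]]; last by rewrite setDE setCK.
  by rewrite (_ : C `&` B = set0)//; apply/seteqP; split=> // x [/CN].
have : level xi w ((C `&` B) `|` (C `\` B)) by rewrite setUIDK.
move=> /tight_prime[||LI|LD].
- exact: basesetI.
- exact: basesetD.
- by apply: (lev_up filx) LI => // x [].
- case: (nofin _ LD); case: cB => [CB|[]//].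
  by rewrite (_ : C `\` B = set0)//; rewrite setD_eq0.
Qed.

(** * The homeomorphism *)

Lemma bpath_open D : @bpath_basis G D -> open D.
Proof. by apply: subbase_open. Qed.

Lemma begins_range y w e : begins y (rcons w e) -> range_of w (src e).
Proof. by move=> /begins_path; rewrite -cats1 => /is_path_src. Qed.

Lemma DcylE w A : genvert A -> Dcyl w A = cyl w A.
Proof.
move=> gA; apply/seteqP; split=> z [h|[C]]; try by left.
  by move=> /= CA zC; right; exists C => //; left.
move=> zC cC; right; exists C => //=; have [tC _ _ _] := finptP zC.
exact: carries_genvert.
Qed.

Lemma cyl_range y u : begins y u -> cyl u (range_of u) y.
Proof.
move=> yu; case: (begins_case yu) => [[e ye]|[C yC]].
  by apply/(cyl_next _ ye); exact: begins_range ye.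
by apply/(cyl_end _ yC); left; have [] := finptP yC.
Qed.

Lemma near_begins y u : begins y u -> (0 < size u)%N ->
  \forall z \near y, begins z u.
Proof.
move=> yu u0; have : nbhs y (Dcyl u (range_of u)).
  have gu : genvert (range_of u).
    by case: (u) u0 => [//|e w] _; exact: genvert_rng.
  apply: open_nbhs_nbhs; split; last by rewrite DcylE//; exact: cyl_range.
  apply: bpath_open; left; exists u, (range_of u); split=> //.
  by split=> //; exact: begins_path yu.
have gu : genvert (range_of u).
  by case: (u) u0 => [//|e w] _; exact: genvert_rng.
by rewrite DcylE//; apply: filterS => z /cyl_begins.
Qed.

Lemma cyl_local y z u w A : begins y u -> begins z u -> (size w < size u)%N ->
  cyl w A z <-> cyl w A y.
Proof.
move=> yu zu lt.
have [e [t eu]] : exists e t, u = take (size w) u ++ e :: t.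
  case ed : (drop (size w) u) => [|e t].
    by move/(congr1 size): ed; rewrite size_drop /= => /eqP; rewrite subn_eq0 leqNgt lt.
  by exists e, t; rewrite -ed cat_take_drop.
have st : size (take (size w) u) = size w by rewrite size_takel// ltnW.
move: (take _ _) st eu => w0 st eu; rewrite eu in yu zu.
case: (pselect (w0 = w)) => [ew|nw].
  by rewrite ew in yu zu; rewrite (cyl_next _ (begins_rcons zu)) (cyl_next _ (begins_rcons yu)).
by split=> /cyl_begins h; case: nw; [have h' := begins_catl zu|have h' := begins_catl yu];
  exact: begins_size h' h st.
Qed.

Lemma in_Xsin_sink w v : in_Xsin (w, [set v]) -> is_sink v.
Proof.
move=> [_ [[v' sv' /= e]|[_ /(_ (finite_set1 _))//]]].
by have -> : v = v' by have : [set v'] v by rewrite -e.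
Qed.

(** Over a beginning of [y] longer than [w] membership in [cyl w A] is decided by the path
    alone.  If the path [u] of [y] is not longer, then a neighborhood of the second kind is
    needed: when [u] is [w] it leaves out the vertices of [C] on the wrong side of [A],
    and otherwise the edge by which [w] continues [u]. *)
Lemma near_cyl y w A : baseset A -> \forall z \near y, cyl w A z <-> cyl w A y.
Proof.
move=> bA.
have long u : begins y u -> (size w < size u)%N ->
    \forall z \near y, cyl w A z <-> cyl w A y.
  move=> yu lt; apply: filterS (near_begins yu (leq_trans (ltn0Sn _) lt)) => z zu.
  exact: cyl_local yu zu lt.
case ey : y => [p ip|[u C] h]; rewrite -ey.
  by apply: (long (mkseq p (size w).+1)); rewrite ?ey /begins size_mkseq.
have yC : finpt (u, C) y by rewrite ey.
have [tC pu Cu hu] := finptP yC.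
case: (ltnP (size w) (size u)) => [lt|le].
  by apply: long lt; apply/hu; exact: prefix_refl.
have point (F : set E) (S : set V) : finite_set F -> F `<=` emits C ->
    finite_set S -> S `<=` C `&` @is_sink G ->
    nbhs y (Dpt u C F S).
  move=> fF FC fS SC; apply: open_nbhs_nbhs; split; last by constructor 1.
  by apply: bpath_open; right; exists u, C, F, S.
case: (pselect (u = w)) => [eu|nu].
  subst u; have [T [TC fT feT hT]] := terminal_split tC bA.
  have : nbhs y (Dpt w C (emits T) (T `&` @is_sink G)).
    apply: point => //; first exact: subset_emits.
      by apply: sub_finite_set fT => x [].
    by move=> x [Tx sx]; split=> //; exact: TC.
  apply: filterS => z; rewrite (cyl_end _ yC).
  case=> [zC|/extendsE[e [Ce nTe] ze]|[v [[Cv nTv] /in_Xsin_sink sv zv]]].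
  - exact: cyl_end.
  - by rewrite (cyl_next _ ze); exact: hT.
  - by rewrite (cyl_end _ zv) carries1; apply: hT => // Tv; apply: nTv.
have no z C' : finpt (u, C') z -> ~ cyl w A z.
  move=> /finptP[_ _ _ hz] /cyl_begins/hz pw; apply: nu.
  move: pw le => /prefixP[t ->]; rewrite size_cat -{2}[size w]addn0 leq_add2l leqn0.
  by move=> /nilP ->; rewrite cats0.
have : nbhs y (Dpt u C (emits C `&` [set` w]) set0).
  apply: point => //.
  by apply: sub_finite_set (finite_seq w) => x [].
apply: filterS => z.
case=> [zC|/extendsE[e [Ce nwe] ze]|[v [_ _ zv]]].
- by split=> [/(no _ _ zC)|/(no _ _ yC)].
- split=> [/cyl_begins zw|/(no _ _ yC)//]; exfalso.
  have zu : begins z u by move: ze; rewrite -cats1; exact: begins_catl.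
  case: (ltngtP (size u) (size w)) le => // [lt _|es _].
    apply: nwe; split=> //=; rewrite -(size_rcons u e) in lt.
    have /prefixP[t ->] := begins_total ze zw lt.
    by rewrite mem_cat mem_rcons mem_head.
  by apply: nu; exact: begins_size zu zw es.
- by split=> [/(no _ _ zv)|/(no _ _ yC)].
Qed.

Lemma tight_of_continuous : continuous tight_of.
Proof.
move=> y.
apply: (@cvg_tight _ (tight_of @ y) (tight_of y) (fmap_filter tight_of (nbhs_filter y))) => -[p|].
  by apply: (near_cyl y (iword p)); exact: iset_base.
by apply: (@filterS _ _ (nbhs_filter y) setT) => //; exact: filterT.
Qed.

Definition bpath_of xi : bpath G := sval (cid (tight_of_surj xi)).

Lemma bpath_ofK : cancel bpath_of tight_of.
Proof. by move=> xi; rewrite /bpath_of; case: cid. Qed.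

Lemma tight_ofK : cancel tight_of bpath_of.
Proof. by move=> y; apply: tight_of_inj; rewrite bpath_ofK. Qed.

Lemma cyl_neq0 w A y : cyl w A y -> A !=set0.
Proof.
case=> [/extendsE[e Ae _]|[C /finptP[tC _ _ _] cA]]; first by exists (src e).
by have [x [_ Ax]] := carries_meet tC cA; exists x.
Qed.

Lemma near_bpath_of xi w A : baseset A -> A `<=` range_of w ->
  \forall eta \near xi, cyl w A (bpath_of eta) <-> cyl w A (bpath_of xi).
Proof.
move=> bA Aw.
have e eta : cyl w A (bpath_of eta) <-> level eta w A.
  rewrite -{2}[eta]bpath_ofK; split=> [h|/lev_boundary_filter[]//].
  apply/lev_boundary_filter; split=> //.
  by split=> //; [exact: begins_path (cyl_begins h)|exact: cyl_neq0 h].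
by apply: filterS (near_level xi w A) => eta; rewrite !e.
Qed.

(** The vertex of [C] itself must not be removed when [C] is a sink listed in [S], because
    the basic set [Dpt w C F S] always contains its center. *)
Lemma DptE w C (F : set E) (S : set V) z :
  in_Xfin (w, C) -> F `<=` emits C -> S `<=` C `&` @is_sink G ->
  Dpt w C F S z <-> [/\ cyl w C z,
    forall e, F e -> ~ cyl (rcons w e) (rng e) z &
    forall v, S v -> [set v] <> C -> ~ cyl w [set v] z].
Proof.
move=> /in_XfinE[[/= pw gC Cw] tC] FC SC; split.
  case=> [zC|/extendsE[e [Ce nFe] ze]|[v [[Cv nSv] /in_Xsin_sink sv zv]]].
  - split; first by apply/(cyl_end _ zC); left.
    + move=> e _ /cyl_begins; rewrite -cats1 => ze.
      by apply: (next_end _ zC); rewrite -cats1; exact: ze.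
    + move=> v Sv nv /(cyl_end _ zC) cv.
      have vC : C `<=` [set v] by apply: carries_genvert cv => //; exact: genvert1.
      apply: nv; apply/seteqP; split=> // _ ->; by have [] := SC _ Sv.
  - split; first by apply/(cyl_next _ ze).
    + move=> f Ff /cyl_begins zf; apply: nFe.
      by rewrite (begins_next_inj ze zf).
    + move=> v Sv _ /(cyl_next _ ze) /= ev; have [_ sv] := SC _ Sv.
      by have : emits [set v] e by []; rewrite sv.
  - split; first by apply/(cyl_end _ zv)/carries1.
    + by move=> e _ /cyl_begins ze; exact: next_end ze zv.
    + by move=> v' Sv' _ /(cyl_end _ zv)/carries1 /= e; apply: nSv; rewrite e.
move=> [zwC hF hS]; case: (begins_case (cyl_begins zwC)) => [[e ze]|[C' zC']].
  constructor 2; apply/extendsE; exists e => //; split.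
    by apply/(cyl_next _ ze).
  move=> Fe; apply: (hF e Fe); have := cyl_range ze.
  by rewrite -cats1 range_of_cat.
have [tC' _ C'w _] := finptP zC'.
move/(cyl_end _ zC'): zwC => /(carries_genvert tC' gC) C'C.
case: (pselect (C' = C)) => [e|ne]; first by constructor 1; rewrite -e.
constructor 3; case: (pselect (finite_set C')) => [fC'|iC']; last first.
  by case: ne; exact: terminal_sub_eq.
have [v ev] := terminal_finite tC' fC'; subst C'.
have Cv : C v by apply: C'C.
have sv : is_sink v.
  apply/eqP; apply: contrapT => /negP /set0P ne0.
  have /terminal1 := tC'; apply; split=> //.
  apply: (terminal_emits tC) => // fC; have [v' eC] := terminal_finite tC fC.
  by apply: ne; rewrite eC; congr set1; move: Cv; rewrite eC.
exists v; split=> //.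
- by split=> // Sv; apply: (hS v Sv ne); apply/(cyl_end _ zC')/carries1.
- by split; [split=> //=; exact: genvert1|left; exists v].
Qed.

Lemma bpath_of_continuous : continuous bpath_of.
Proof.
apply: (subbase_continuous (D := @bpath_basis G)) => // D.
suff near_basic xi : bpath_basis D -> \forall eta \near xi, D (bpath_of eta) <-> D (bpath_of xi).
  move=> bD; rewrite openE => xi xiD.
  by apply: filterS (near_basic xi bD) => eta [_]; apply.
case=> [[b [B [[/= pb gB Bb] b0 ->]]]|[b [B [F [S [xB [fF FB] [fS SB] ->]]]]]].
  by rewrite DcylE//; apply: near_bpath_of => //; exact: baseset_genvert.
have [[/= pb gB Bb] tB] := (in_XfinE _).1 xB.
have nB := near_bpath_of xi (baseset_genvert gB) Bb.
have nF : \forall eta \near xi, forall e, F e ->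
    (cyl (rcons b e) (rng e) (bpath_of eta) <-> cyl (rcons b e) (rng e) (bpath_of xi)).
  apply: near_finite => // e _; apply: near_bpath_of; first exact: baseset_rng.
  by rewrite -cats1 range_of_cat.
have nS : \forall eta \near xi, forall v, S v ->
    (cyl b [set v] (bpath_of eta) <-> cyl b [set v] (bpath_of xi)).
  apply: near_finite => // v Sv; apply: near_bpath_of; first exact: baseset1.
  by move=> _ ->; apply: Bb; have [] := SB _ Sv.
apply: filterS (filterI nB (filterI nF nS)) => eta [hB [hF hS]].
rewrite !DptE//; split=> -[cB cF cS]; split.
- exact/hB.
- by move=> e Fe /(hF e Fe); exact: cF.
- by move=> v Sv vB /(hS v Sv); exact: cS.
- exact/hB.
- by move=> e Fe /(hF e Fe); exact: cF.
- by move=> v Sv vB /(hS v Sv); exact: cS.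
Qed.

(** * The shifts *)

Lemma tight_ge_tight_of n y : tight_ge n (tight_of y) <-> bpath_ge n y.
Proof.
split=> [[a /has_word_tight_of <-]|yn].
  by case: (y).
by exists (word_of y); [apply/has_word_tight_of|case: (y) yn].
Qed.

Lemma given_by_inj xi xi' w (F : set (set V)) : given_by xi w F -> given_by xi' w F -> xi = xi'.
Proof.
have [y ->] := tight_of_surj xi; have [y' ->] := tight_of_surj xi'.
move=> [/has_word_tight_of yw yF] [/has_word_tight_of yw' yF']; congr tight_of.
apply: bpath_word_level; first by rewrite yw.
by rewrite yw => _ [<-]; rewrite yF.
Qed.

Lemma has_inf_word_inj xi xi' p :
  has_word xi (InfWord p) -> has_word xi' (InfWord p) -> xi = xi'.
Proof.
have [y ->] := tight_of_surj xi; have [y' ->] := tight_of_surj xi'.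
move=> /has_word_tight_of yw /has_word_tight_of yw'; congr tight_of.
by apply: bpath_word_level; rewrite yw.
Qed.

Lemma has_word_inj xi a b : has_word xi a -> has_word xi b -> a = b.
Proof. by have [y ->] := tight_of_surj xi; move=> /has_word_tight_of <- /has_word_tight_of. Qed.

(** The three clauses concern words of different kinds, and each clause names
    the word of the shifted filter, with its sets over that word if it is finite. *)
Lemma is_shift_fun xi eta eta' : is_shift xi eta -> is_shift xi eta' -> eta = eta'.
Proof.
case=> [[p hp h]|[e [f [w [hw h]]]]|[e he h]];
  case=> [[p' hp' h']|[e' [f' [w' [hw' h']]]]|[e' he' h']].
- by move: h'; have [<-] := has_word_inj hp hp'; exact: has_inf_word_inj.
- by have := has_word_inj hp hw'.
- by have := has_word_inj hp he'.
- by have := has_word_inj hw hp'.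
- by move: h'; have [<- <- <-] := has_word_inj hw hw'; exact: given_by_inj.
- by have := has_word_inj hw he'.
- by have := has_word_inj he hp'.
- by have := has_word_inj he hw'.
- by move: h'; have [<-] := has_word_inj he he'; exact: given_by_inj.
Qed.

Lemma level_finpt w C y : finpt (w, C) y ->
  level (tight_of y) w = [set A | valid w A /\ carries C A].
Proof.
move=> yC; apply/seteqP; split=> A.
  by move=> /lev_boundary_filter[vA /(cyl_end _ yC)].
by move=> [vA cA]; apply/lev_boundary_filter; split=> //; apply/(cyl_end _ yC).
Qed.

Lemma is_shift_tight_of y : bpath_ge 1 y -> is_shift (tight_of y) (tight_of (bpath_shift y)).
Proof.
case: y => [p ip|[[//|e [|f w]] C] h] _.
- by constructor 1; exists p; apply/has_word_tight_of.
- constructor 3; exists e; first exact/has_word_tight_of.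
  split; first exact/has_word_tight_of.
  rewrite (@level_finpt [::] C)// (@level_finpt [:: e] C)//.
  have [tC pe Ce _] := @finptP [:: e] C (BFin h) erefl.
  apply/seteqP; split=> A /=.
    move=> [[_ _ bA _] cA]; split=> //; exists (C `&` A); last by move=> x [].
    split; last by apply: carriesI => //; left.
    split=> //; first exact: carries_meet.
      by apply: basesetI => //; exact: terminal_baseset.
    by move=> x [/Ce].
  move=> [bA [B [[_ B0 _ _] cB] BA]]; split; last exact: carriesS cB.
  by split=> //; exact: subset_nonempty B0.
- constructor 2; exists e, f, w; split; first exact/has_word_tight_of.
  split; first exact/has_word_tight_of.
  rewrite (@level_finpt (f :: w) C)// (@level_finpt [:: e, f & w] C)//.
  have [_ pw _ _] := @finptP [:: e, f & w] C (BFin h) erefl.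
  have pw' : is_path (f :: w) by move: pw => /andP[].
  by apply/seteqP; split=> A /= [[_ A0 bA Ar] cA].
Qed.

Lemma tight_shift_tight_of y : bpath_ge 1 y -> tight_shift (tight_of y) = tight_of (bpath_shift y).
Proof.
move=> y1; have sh := is_shift_tight_of y1.
by apply: xget_unique => // eta; move: sh => /[swap]; exact: is_shift_fun.
Qed.

Lemma boundary_conjugacy :
  conjugacy (@bpath_ge G) (@tight_ge G) (@bpath_shift G) (@tight_shift G) tight_of bpath_of.
Proof.
split.
- by split; [exact: tight_ofK|exact: bpath_ofK].
- by split; [exact: tight_of_continuous|exact: bpath_of_continuous].
- exact: tight_ge_tight_of.
- by move=> n [//|[[|e w] C] h] /=.
- move=> n y yn; apply: tight_shift_tight_of.
  by case: y yn => [//|x h] /=; apply: leq_trans.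
Qed.

End Boundary.

Theorem proposition3p21 (G : ultragraph) (hG : RFUM2 G) :
  topological_groupoid_iso (boundary_groupoid G) (tight_groupoid G).
Proof. exact: conjugacy_groupoid_iso (boundary_conjugacy hG). Qed.
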